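(* Let $w\ge 4$, $u=w-2$, $v=w-1$, and let $\sum$ denote the sum over positive integers $b,c$ with $b+c=v$ (so the indices $(1,b,c)$ have weight $w$). Then, as identities of polynomials in $T$, \begin{align*} \sum \zeta_\sqcup(1,b,c)&=\zeta(2,u)+\zeta_*(1,v)+\zeta_*(1,1,u)-\tfrac12\zeta(2)\zeta(u),\\ \sum \zeta_\sqcup(1,\bar b,c)&=\zeta(\bar2,\bar u)+\zeta_*(1,v)+\zeta_*(1,\bar1,\bar u)+\zeta_*(1,\bar u,\bar1)+\zeta(\bar1,1,\bar u)-\zeta(\bar1,\bar1,\bar u)-\zeta_*(1,\bar u,1),\\ \sum \zeta(\bar1,b,c)&=\zeta(2,u)+\zeta(\bar1,\bar v)+\zeta(\bar1,u,\bar1)+2\zeta(\bar1,\bar1,u)-\zeta(\bar1,1,u)-\zeta(\bar1,u,1),\\ \sum \zeta(\bar1,\bar b,c)&=\zeta(\bar2,\bar u)+\zeta(\bar1,\bar v)+\zeta(\bar1,1,\bar u),\\ \sum \zeta(\bar1,\bar b,\bar c)&=\zeta(\bar2,u)+\zeta(\bar1,v)+\zeta(\bar1,u,1)+\zeta(\bar1,1,u)-\zeta(\bar1,u,\bar1),\\ \sum \zeta_\sqcup(1,b,\bar c)&=\zeta(2,\bar u)+\zeta_*(1,\bar v)+\zeta_*(1,\bar u,1)+\zeta_*(1,1,\bar u)-\zeta_\sqcup(1,\bar u,\bar1)-\tfrac12\zeta(2)\zeta(\bar u),\\ \sum \zeta_\sqcup(1,\bar b,\bar c)&=\zeta(\bar2,u)+\zeta_*(1,\bar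 v)+\zeta_*(1,\bar1,u)+\zeta(\bar1,1,u)-\zeta(\bar1,\bar1,u),\\ \sum \zeta(\bar1,b,\bar c)&=\zeta(2,\bar u)+\zeta(\bar1,v)+2\zeta(\bar1,\bar1,\bar u)-\zeta(\bar1,1,\bar u). \end{align*}
   Context: Euler sums: for positive integers $s_j$ and $z_j\in\{\pm1\}$, $\zeta(s_1,\dots,s_d;z_1,\dots,z_d)=\sum_{n_1>\dots>n_d>0}\frac{z_1^{n_1}\cdots z_d^{n_d}}{n_1^{s_1}\cdots n_d^{s_d}}$, convergent iff $(s_1,z_1)\ne(1,1)$; a bar over the $j$-th argument means $z_j=-1$, no bar means $z_j=1$. Regularized values: the truncated sum $\zeta^{(M)}$ (restricted to $M\ge n_1$) has, as $M\to\infty$, an expansion $P(\log M+\gamma)+o(1)$ with $P$ a polynomial ($\gamma$ Euler's constant); $\zeta_*:=P(T)\in\mathbb{R}[T]$. With $a_k=\prod_{j\le k}z_j$, $\int_0^{1-\varepsilon}\left(\frac{dt}{t}\right)^{s_1-1}\frac{dt}{a_1-t}\cdots\left(\frac{dt}{t}\right)^{s_d-1}\frac{dt}{a_d-t}$ (iterated integral over $1-\varepsilon>t_1>t_2>\dots>0$, forms read left to right) has, as $\varepsilon\to0^+$, an expansion $Q(-\log\varepsilon)+o(1)$; $\zeta_\sqcup:=Q(T)$. Both equal the Euler sum for convergent indices. *)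

(* Defs.v *)
From HB Require Import structures.
From mathcomp Require Import all_boot all_order all_algebra.
From mathcomp Require Import all_classical all_reals all_analysis.
Set Implicit Arguments. Unset Strict Implicit. Unset Printing Implicit Defensive.
Import Order.TTheory GRing.Theory Num.Theory.
Import numFieldNormedType.Exports.
Local Open Scope classical_set_scope.
Local Open Scope ring_scope.

(* An index entry (s, b) : nat * bool stands for the argument s with sign
   z = -1 if b = true (a bar over s) and z = 1 if b = false. *)
Definition idx := seq (nat * bool).
Definition pos (s : nat) : nat * bool := (s, false).
Definition bar (s : nat) : nat * bool := (s, true).

Section EulerSums.
Variable R : realType.

Definition zsign (b : bool) : R := if b then -1 else 1.

Fixpoint ztrunc (k : idx) (M : nat) : R :=
  match k with
  | [::] => 1
  | (s, b) :: k' =>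
      \sum_(1 <= n < M.+1) (zsign b ^+ n / (n%:R) ^+ s) * ztrunc k' n.-1
  end.

(* the Euler sum (value for convergent indices) *)
Definition zeta (k : idx) : R := limn (ztrunc k).

Definition euler_gamma : R :=
  limn (fun n : nat => \sum_(1 <= j < n.+1) (j%:R)^-1 - ln (n%:R : R)).

Definition stuffle_reg (k : idx) (P : {poly R}) : Prop :=
  (fun M : nat => ztrunc k M - P.[ln (M%:R : R) + euler_gamma]) @ \oo --> (0 : R).

(* the (unique) such polynomial zeta_* *)
Definition zeta_st (k : idx) : {poly R} :=
  match pselect (exists P, stuffle_reg k P) with
  | left h => projT1 (cid h)
  | right _ => 0
  end.

Definition form_val (f : option R) (t : R) : R :=
  match f with None => t^-1 | Some a => (a - t)^-1 end.

Fixpoint itint (w : seq (option R)) (x : R) : R :=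
  match w with
  | [::] => 1
  | f :: w' =>
      \int[@lebesgue_measure R]_(t in `[0%R, x]) (form_val f t * itint w' t)
  end.

(* (dt/t)^{s_1-1} dt/(a_1-t) ... (dt/t)^{s_d-1} dt/(a_d-t), a_k = z_1...z_k *)
Fixpoint word_aux (a : R) (k : idx) : seq (option R) :=
  match k with
  | [::] => [::]
  | (s, b) :: k' =>
      let a' := a * zsign b in nseq s.-1 None ++ (Some a' :: word_aux a' k')
  end.
Definition word (k : idx) : seq (option R) := word_aux 1 k.

Definition shuffle_reg (k : idx) (Q : {poly R}) : Prop :=
  (fun eps : R => itint (word k) (1 - eps) - Q.[- ln eps]) @ 0^'+ --> (0 : R).

Definition zeta_sh (k : idx) : {poly R} :=
  match pselect (exists Q, shuffle_reg k Q) with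
  | left h => projT1 (cid h)
  | right _ => 0
  end.

End EulerSums.

(* Main.v *)
Require Import Defs.
From HB Require Import structures.
From mathcomp Require Import all_boot all_order all_algebra.
From mathcomp Require Import all_classical all_reals all_analysis.
From mathcomp Require Import ring lra.
From mathcomp Require polyrcf.

(* Write [a_1, a_2, a_3] for the partial products of the three signs.  Summing
   the words of [(1, b, c)] over [b + c = u + 1] amounts to inserting the letter
   [dt/(a_2 - t)] in all positions strictly between the outer letters of the word
   of [(1, u)]; hence the sum is the shuffle product of [(1)] and [(1, u)] minus
   the two extreme insertions.  Re-expanding the same product by the stuffle
   relation gives the right-hand sides, once the two regularizations are compared.

   For that comparison, every truncated sum with at most two leading ones is
   [c + d H_M + r ztrunc [1, 1] M + O(M^(-1/2))].  On the stuffle side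
   [H_M^2 = 2 ztrunc [1, 1] M + ztrunc [2] M] turns [ztrunc [1, 1]] into
   [(T^2 - zeta(2)) / 2]; on the shuffle side the iterated integral at [1 - eps]
   is [eps * sum_M (ztrunc k M) (1 - eps)^M], which sends [H_M] to [- ln eps] and
   [ztrunc [1, 1]] to [(ln eps)^2 / 2] exactly.  So the two polynomials differ only
   by [r zeta(2) / 2], with [r = zeta k'] for [k = (1, 1, k')]. *)
Set Implicit Arguments. Unset Strict Implicit. Unset Printing Implicit Defensive.
Import Order.TTheory GRing.Theory Num.Theory.
Import numFieldNormedType.Exports.
Local Open Scope classical_set_scope.
Local Open Scope ring_scope.

(** * Growth and convergence rates of truncated Euler sums *)

Section SquareRootRate.
Variable R : realType.
Implicit Types (a e : nat -> R) (k : idx).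

(** The error scale. Powers of logarithms are absorbed by a square root, so truncated sums stay
    below a multiple of [rt] and remainders below a multiple of its inverse; the shift keeps it
    nonzero at 0. *)
Definition rt (n : nat) : R := Num.sqrt n.+1%:R.

Lemma rt_gt0 n : 0 < rt n.
Proof. by rewrite sqrtr_gt0 ltr0n. Qed.

Lemma rt_sqr n : rt n ^+ 2 = n.+1%:R.
Proof. by rewrite sqr_sqrtr // ler0n. Qed.

Lemma rt_ge1 n : 1 <= rt n.
Proof. by rewrite -[X in X <= _]sqrtr1 ler_sqrt ?ler1n ?ltr0n. Qed.

Lemma rt_sqrS n : rt n.+1 ^+ 2 = rt n ^+ 2 + 1.
Proof. by rewrite !rt_sqr -(natr1 n.+1). Qed.

Lemma rt_leS n : rt n <= rt n.+1.
Proof. by have := rt_sqrS n; have := rt_gt0 n; have := rt_gt0 n.+1; nra. Qed.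

Lemma rt_leS2 n : rt n.+1 <= 2 * rt n.
Proof. by have := rt_sqrS n; have := rt_ge1 n; have := rt_gt0 n.+1; nra. Qed.

(** With x, y the consecutive roots, y^2 - x^2 = 1 gives y - x = 1 / (x + y), and y <= 2 x gives the
    constant 3. *)
Lemma rt_diff n : (rt n)^-1 <= 3 * (rt n.+1 - rt n).
Proof.
have := rt_sqrS n; have := rt_gt0 n; have := rt_leS n; have := rt_leS2 n.
move: (rt n) (rt n.+1) => x y h1 h2 x0 h3.
rewrite -div1r ler_pdivrMr //; nra.
Qed.

(** Here 1/x - 1/y = 1 / (x y (x + y)), and y <= 2 x bounds y (x + y) by 6 x^2. *)
Lemma invrt_diff n : (rt n ^+ 3)^-1 <= 6 * ((rt n)^-1 - (rt n.+1)^-1).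
Proof.
have := rt_sqrS n; have := rt_gt0 n; have := rt_leS n; have := rt_leS2 n.
move: (rt n) (rt n.+1) => x y h1 h2 x0 h3.
have y0 : 0 < y by lra.
have -> : x^-1 - y^-1 = (x * y * (x + y))^-1.
  have -> : (x * y * (x + y))^-1 = (y ^+ 2 - x ^+ 2) / (x * y * (x + y)).
    by rewrite h3 addrAC subrr add0r mul1r.
  by field; rewrite !gt_eqF //; lra.
rewrite -div1r ler_pdivrMr ?exprn_gt0 // mulrAC ler_pdivlMr ?mulr_gt0 //; last lra.
rewrite mul1r exprS.
have : y * (x + y) <= 6 * x ^+ 2 by nra.
by rewrite -mulrA -(ler_pM2l x0); lra.
Qed.

Definition rate e := exists C : R, forall n, `|e n| <= C / rt n.
Definition growth a := exists C : R, forall n, `|a n| <= C * rt n.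

Lemma rateD e1 e2 : rate e1 -> rate e2 -> rate (fun n => e1 n + e2 n).
Proof.
move=> [C h] [D g]; exists (C + D) => n.
by rewrite (le_trans (ler_normD _ _)) // mulrDl lerD.
Qed.

Lemma rateM (c : R) e : rate e -> rate (fun n => c * e n).
Proof.
move=> [C h]; exists (`|c| * C) => n.
by rewrite normrM -mulrA ler_wpM2l.
Qed.

Lemma rate0 : rate (fun=> 0).
Proof. by exists 0 => n; rewrite normr0 mul0r. Qed.

Lemma invrt_cvg0 : (fun n => (rt n)^-1) @ \oo --> (0 : R).
Proof.
apply/gtr0_cvgV0; first by near=> n; exact: rt_gt0.
apply/cvgryPge => A; near=> n.
rewrite (le_trans (ler_norm A)) // -sqrtr_sqr ler_sqrt ?ltr0n //.
rewrite (@le_trans _ _ n%:R) ?ler_nat //.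
by near: n; exact: nbhs_infty_ger.
Unshelve. all: by end_near. Qed.

Lemma rate_cvg0 e : rate e -> e @ \oo --> 0.
Proof.
move=> [C h]; apply: norm_cvg0.
apply: (squeeze_cvgr (f := fun=> 0) (h := fun n => C * (rt n)^-1)).
- by near=> n; rewrite normr_ge0 h.
- exact: cvg_cst.
- by rewrite -[X in _ --> X](mulr0 C); apply: cvgM; [exact: cvg_cst|exact: invrt_cvg0].
Unshelve. all: by end_near. Qed.

(** By [invrt_diff] the increments of [a] are dominated by those of 6 C / [rt]. Adding this quantity
    makes [a] nonincreasing, subtracting it nondecreasing, and the limit is squeezed between the
    two. *)
Lemma rate_increments a C : (forall n, `|a n.+1 - a n| <= C / rt n ^+ 3) ->
  exists l, rate (fun n => a n - l).
Proof.
move=> h.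
have C0 : 0 <= C.
  have := le_trans (normr_ge0 _) (h 0%N).
  by rewrite pmulr_lge0 // invr_gt0 exprn_gt0 // rt_gt0.
have step n : `|a n.+1 - a n| <= 6 * C * ((rt n)^-1 - (rt n.+1)^-1).
  apply: le_trans (h n) _; rewrite [6 * C]mulrC -mulrA ler_wpM2l //.
  exact: invrt_diff.
pose up n := a n + 6 * C / rt n; pose lo n := a n - 6 * C / rt n.
have up_dec : {homo up : n m / (n <= m)%N >-> m <= n}.
  apply/nonincreasing_seqP => n; rewrite /up.
  by have := step n; rewrite ler_norml mulrBr => /andP[_]; lra.
have lo_inc : {homo lo : n m / (n <= m)%N >-> n <= m}.
  apply/nondecreasing_seqP => n; rewrite /lo.
  by have := step n; rewrite ler_norml mulrBr => /andP[+ _]; lra.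
have lo_up n : lo n <= up n.
  have : 0 <= 6 * C / rt n by rewrite divr_ge0 ?mulr_ge0 // ltW ?rt_gt0.
  by rewrite /lo /up; lra.
have lo_le_up n m : lo n <= up m.
  case/orP: (leq_total n m) => nm.
    by rewrite (le_trans (lo_inc _ _ nm)).
  by rewrite (le_trans (lo_up _)) // up_dec.
have cup : cvgn up.
  apply: nonincreasing_is_cvgn => //; exists (lo 0%N) => _ [n _ <-].
  exact: lo_le_up.
exists (limn up), (6 * C) => n.
have := nonincreasing_cvgn_ge up_dec cup n.
have : lo n <= limn up by apply: limr_ge => //; near=> m; exact: lo_le_up.
by rewrite /lo /up ler_norml => h1 h2; apply/andP; split; lra.
Unshelve. all: by end_near. Qed.

Lemma ztruncS s b k M : ztrunc R ((s, b) :: k) M.+1 =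
  ztrunc R ((s, b) :: k) M + zsign R b ^+ M.+1 / M.+1%:R ^+ s * ztrunc R k M.
Proof. by rewrite /= big_nat_recr. Qed.

Lemma ztrunc0 s b k : ztrunc R ((s, b) :: k) 0 = 0.
Proof. by rewrite /= big_geq. Qed.

Lemma normr_zsign b n : `|zsign R b ^+ n| = 1.
Proof. by rewrite normrX; case: b; rewrite /= ?normrN normr1 expr1n. Qed.

(** The outermost summation of [ztrunc], with any inner sequence allowed, so that it can also be
    applied to remainders. *)
Definition psum s b a M : R :=
  \sum_(1 <= n < M.+1) (zsign R b ^+ n / n%:R ^+ s) * a n.-1.

Lemma psumS s b a M :
  psum s b a M.+1 = psum s b a M + zsign R b ^+ M.+1 / M.+1%:R ^+ s * a M.
Proof. by rewrite /psum big_nat_recr. Qed.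

Lemma psum_term_le s b a C M : `|a M| <= C * rt M ->
  `|zsign R b ^+ M.+1 / M.+1%:R ^+ s.+1 * a M| <= C / rt M ^+ (s.*2.+1).
Proof.
move=> h; have r0 := rt_gt0 M.
rewrite !normrM normr_zsign mul1r normfV normrX -rt_sqr normrX (gtr0_norm r0).
rewrite -exprM mul2n doubleS mulrC ler_pdivrMr ?exprn_gt0 //.
by rewrite (le_trans h) // [X in _ <= _ * X]exprSr mulrA mulfVK // gt_eqF ?exprn_gt0.
Qed.

(** The terms are at most C / [rt M], and [rt_diff] telescopes their sum to 3 C [rt]; the bound by a
    square root thus survives every further argument. *)
Lemma psum_growth s b a : growth a -> growth (psum s.+1 b a).
Proof.
move=> [C h]; have C0 : 0 <= C.
  by have := le_trans (normr_ge0 _) (h 0%N); rewrite pmulr_lge0 // rt_gt0.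
exists (3 * C); elim=> [|M IH].
  by rewrite /psum big_geq // normr0 mulr_ge0 ?mulr_ge0 // ltW ?rt_gt0.
rewrite psumS (le_trans (ler_normD _ _)) //.
have := psum_term_le s b (h M).
set x := `|_|; move=> hx.
have {}hx : x <= C / rt M.
  apply: le_trans hx _; rewrite ler_wpM2l // lef_pV2 ?posrE ?exprn_gt0 ?rt_gt0 //.
  by rewrite -[X in X <= _]expr1 ler_weXn2l ?rt_ge1.
have : C / rt M <= C * (3 * (rt M.+1 - rt M)) by rewrite ler_wpM2l ?rt_diff.
by move: IH; lra.
Qed.

Lemma psum_rate2 s b a : growth a ->
  exists l, rate (fun M => psum s.+2 b a M - l).
Proof.
move=> [C h]; have C0 : 0 <= C.
  by have := le_trans (normr_ge0 _) (h 0%N); rewrite pmulr_lge0 // rt_gt0.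
apply: (@rate_increments _ C) => M; rewrite psumS addrAC subrr add0r.
apply: le_trans (psum_term_le s.+1 b (h M)) _.
rewrite ler_wpM2l // lef_pV2 ?posrE ?exprn_gt0 ?rt_gt0 //.
by rewrite ler_weXn2l ?rt_ge1 // !doubleS.
Qed.

(** Dividing a remainder of order n^(-1/2) by n makes it summable, so putting an unbarred 1 in front
    turns it into a constant and a remainder of the same order. *)
Lemma psum_rate1 a : rate a -> exists l, rate (fun M => psum 1 false a M - l).
Proof.
move=> [C h]; apply: (@rate_increments _ C) => M; rewrite psumS addrAC subrr add0r.
rewrite expr1n expr1 -rt_sqr normrM normrM normr1 mul1r gtr0_norm; last first.
  by rewrite invr_gt0 exprn_gt0 ?rt_gt0.
have r0 := rt_gt0 M; rewrite mulrC ler_pdivrMr ?exprn_gt0 // (le_trans (h M)) //.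
by rewrite [X in _ <= _ / X * _]exprS invfM -mulrA mulfVK // gt_eqF ?exprn_gt0.
Qed.

(* The alternating sum is, up to summable terms, the increment of
   [(-1)^n a(n) / (2 (n + 1))]. *)
Lemma psum_rate_alt a : growth a ->
  (exists D, forall n, `|a n.+1 - a n| <= D / rt n) ->
  exists l, rate (fun M => psum 1 true a M - l).
Proof.
move=> [C h] [D g].
pose t n : R := 2^-1 * ((-1) ^+ n * (a n / n.+1%:R)).
have [|l hl] := @rate_increments (fun n => psum 1 true a n - t n) (C + D).
  move=> n; rewrite psumS /t expr1 /=.
  have := h n; have := g n; rewrite -(rt_sqr n) -(rt_sqr n.+1) rt_sqrS (exprS (-1)).
  have := rt_ge1 n; move: ((-1) ^+ n) (normr_zsign true n) => z /= hz.
  move: (rt n) (a n) (a n.+1) => r x y r1 hy hx.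
  have r0 : 0 < r by lra.
  (* The leftover increment has one part from the variation of [a], controlled by [D], and one from
     the variation of 1 / (n + 1), controlled by [C]; both are of order n^(-3/2). *)
  have -> : psum 1 true a n + -1 * z / r ^+ 2 * x -
      2^-1 * (-1 * z * (y / (r ^+ 2 + 1))) -
      (psum 1 true a n - 2^-1 * (z * (x / r ^+ 2))) =
      z * (2^-1 * ((y - x) / (r ^+ 2 + 1) - x / (r ^+ 2 * (r ^+ 2 + 1)))).
    by field; rewrite !gt_eqF //; nra.
  have r3 : 0 < r ^+ 3 by rewrite exprn_gt0.
  have C0 : 0 <= C by have := le_trans (normr_ge0 _) hx; rewrite pmulr_lge0.
  have D0 : 0 <= D by have := le_trans (normr_ge0 _) hy; rewrite pmulr_lge0 ?invr_gt0.
  have hp : `|(y - x) / (r ^+ 2 + 1)| <= D / r ^+ 3.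
    have r21 : 0 < r ^+ 2 + 1 by nra.
    rewrite normrM normfV (gtr0_norm r21) ler_pdivrMr //.
    have -> : D / r ^+ 3 * (r ^+ 2 + 1) = D / r + D / r ^+ 3 by field; rewrite gt_eqF.
    by rewrite (le_trans hy) // lerDl divr_ge0 // ltW.
  have hq : `|x / (r ^+ 2 * (r ^+ 2 + 1))| <= C / r ^+ 3.
    have r2 : 0 < r ^+ 2 by rewrite exprn_gt0.
    have rr : 0 < r ^+ 2 * (r ^+ 2 + 1) by rewrite mulr_gt0 //; lra.
    rewrite normrM normfV (gtr0_norm rr) ler_pdivrMr //.
    have -> : C / r ^+ 3 * (r ^+ 2 * (r ^+ 2 + 1)) = C * r + C / r.
      by field; rewrite gt_eqF.
    by rewrite (le_trans hx) // lerDl divr_ge0 // ltW.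
  rewrite normrM hz mul1r mulrDl.
  by move: hp hq; rewrite !ler_norml => /andP[? ?] /andP[? ?]; apply/andP; split; lra.
exists l; have -> : (fun M => psum 1 true a M - l) = (fun M => (psum 1 true a M - t M - l) + t M).
  by apply/funext => M; ring.
apply: rateD => //; apply: rateM; exists C => n.
rewrite normrM (normr_zsign true) mul1r normrM normfV -rt_sqr.
have r0 := rt_gt0 n; have r2 : 0 < rt n ^+ 2 by rewrite exprn_gt0.
rewrite (gtr0_norm r2) ler_pdivrMr // (le_trans (h n)) //.
by rewrite expr2 mulrA mulfVK // gt_eqF.
Qed.

Definition positive_idx k := all (fun p => 0 < p.1)%N k.

(** The empty index counts as convergent, which makes (1) and (1, 1) instances of leading ones
    before a convergent index. *)
Definition convergent_idx k := if k is p :: _ then p != pos 1 else true.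

Lemma ztrunc_growth k : positive_idx k -> growth (ztrunc R k).
Proof.
elim: k => [_|[[|s] b] k IH] //=.
  by exists 1 => n; rewrite normr1 mul1r rt_ge1.
by move=> /IH; exact: psum_growth.
Qed.

Lemma ztrunc_increments k : positive_idx k ->
  exists D, forall n, `|ztrunc R k n.+1 - ztrunc R k n| <= D / rt n.
Proof.
case: k => [_|[[|s] b] k] //.
  by exists 0 => n; rewrite subrr normr0 mul0r.
move=> pk; have [C h] := @ztrunc_growth k pk; exists C => n.
have C0 : 0 <= C.
  by have := le_trans (normr_ge0 _) (h 0%N); rewrite pmulr_lge0 // rt_gt0.
rewrite ztruncS addrAC subrr add0r (le_trans (psum_term_le s b (h n))) //.
rewrite ler_wpM2l // lef_pV2 ?posrE ?exprn_gt0 ?rt_gt0 //.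
by rewrite -[X in X <= _]expr1 ler_weXn2l ?rt_ge1.
Qed.

Lemma ztrunc_cvg k : positive_idx k -> convergent_idx k ->
  exists l, rate (fun M => ztrunc R k M - l).
Proof.
case: k => [|[[|[|s]] b] k] //=.
- by exists 1; under eq_fun do rewrite subrr; exact: rate0.
- case: b => // pk _; apply: psum_rate_alt; first exact: ztrunc_growth.
  exact: ztrunc_increments.
- by move=> /ztrunc_growth/psum_rate2 h _; exact: h.
Qed.

Lemma zeta_rate k : positive_idx k -> convergent_idx k ->
  rate (fun M => ztrunc R k M - zeta R k).
Proof.
move=> pk ck; have [l hl] := ztrunc_cvg pk ck.
suff -> : zeta R k = l by [].
by apply: cvg_lim => //; apply/subr_cvg0; exact: rate_cvg0.
Qed.

(** The basis 1, H_M, [ztrunc [1, 1] M] is preferred to powers of the logarithm because putting an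
    unbarred 1 in front sends each element exactly to the next. *)
Definition expansion k (c d e : R) := rate (fun M =>
  ztrunc R k M - (c + d * ztrunc R [:: pos 1] M + e * ztrunc R [:: pos 1; pos 1] M)).

Lemma expansion_convergent k : positive_idx k -> convergent_idx k ->
  expansion k (zeta R k) 0 0.
Proof.
move=> pk ck; have := zeta_rate pk ck; rewrite /expansion.
by under [in X in _ -> X]eq_fun do rewrite !mul0r !addr0.
Qed.

(** Summation with weight 1/n shifts the coefficients by one place; the remainder contributes only
    the new constant, by [psum_rate1]. *)
Lemma expansion_cons1 k c d : expansion k c d 0 ->
  exists c', expansion (pos 1 :: k) c' c d.
Proof.
move=> /psum_rate1[c' h]; exists c'; move: h; rewrite /expansion.
congr (rate _); apply/funext => M.
suff -> : psum 1 false (fun M => ztrunc R k M - (c + d * ztrunc R [:: pos 1] M +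
    0 * ztrunc R [:: pos 1; pos 1] M)) M = ztrunc R (pos 1 :: k) M -
    (c * ztrunc R [:: pos 1] M + d * ztrunc R [:: pos 1; pos 1] M) by ring.
elim: M => [|M IH]; first by rewrite !ztrunc0 /psum big_geq //; ring.
by rewrite psumS IH !ztruncS [ztrunc R [::] M]/=; ring.
Qed.

Lemma expansion_lead1 k : positive_idx k -> convergent_idx k || convergent_idx (behead k) ->
  exists c d, expansion k c d 0.
Proof.
move=> pk; case: (boolP (convergent_idx k)) => [ck _|].
  by exists (zeta R k), 0; exact: expansion_convergent.
case: k pk => // p k pk /=; rewrite negbK => /eqP pE ck; subst p.
have [c h] := expansion_cons1 (expansion_convergent (k := k) pk ck).
by exists c, (zeta R k).
Qed.

(* At most two leading unbarred ones: the regularized values have degree at most 2. *)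
Definition low_lead k :=
  [|| convergent_idx k, convergent_idx (behead k) | convergent_idx (behead (behead k))].

Lemma expansion_lead2 k : positive_idx k -> low_lead k ->
  exists c d (r : R), expansion k c d r.
Proof.
move=> pk; rewrite /low_lead orbA => /orP[ck|].
  by have [c [d h]] := expansion_lead1 pk ck; exists c, d, 0.
case: (boolP (convergent_idx k)) => [ck _|].
  by have [|c [d h]] := expansion_lead1 pk; rewrite ?ck //; exists c, d, 0.
case: k pk => // p k pk /=; rewrite negbK => /eqP pE ck; subst p.
have [|c [d h]] := expansion_lead1 (k := k) pk; first by rewrite ck orbT.
have [c' h'] := expansion_cons1 h.
by exists c', c, d.
Qed.

End SquareRootRate.

(** * Stuffle product with an index of depth one *)

Section Stuffle.
Variable R : realType.

(* The terms of the stuffle product of [[:: p]] and [k]. *)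
Fixpoint stuffle1 (p : nat * bool) (k : idx) : seq idx :=
  if k is q :: k' then
    [:: p :: k, (p.1 + q.1, p.2 (+) q.2)%N :: k' & map (cons q) (stuffle1 p k')]
  else [:: [:: p]].

Lemma zsignD b c : zsign R (b (+) c) = zsign R b * zsign R c.
Proof. by case: b c => [] [] /=; rewrite ?mulrNN ?mulr1 ?mul1r. Qed.

(** Induction on M inside induction on [k]. The new term of the first factor puts [p] in front; that
    of the second carries the product of [[:: p]] with the tail, expanded by the induction
    hypothesis; the product of both merges the heads. *)
Lemma ztrunc_stuffle1 p k M :
  ztrunc R [:: p] M * ztrunc R k M = \sum_(k' <- stuffle1 p k) ztrunc R k' M.
Proof.
case: p => s b; elim: k M => [|[s' b'] k IH] M; first by rewrite big_seq1 mulr1.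
rewrite [stuffle1 _ _]/= !big_cons big_map.
elim: M => [|M IHM].
  rewrite !ztrunc0 mul0r !add0r big1 // => k' _; exact: ztrunc0.
under eq_bigr do rewrite ztruncS.
rewrite big_split -mulr_sumr -IH !ztruncS exprD [ztrunc R [::] M]/=.
move: IHM; rewrite zsignD exprMn.
set K := ztrunc R k M; set A := ztrunc R [:: (s, b)] M; set B := ztrunc R ((s', b') :: k) M.
move=> AB; transitivity (A * B + zsign R b ^+ M.+1 / M.+1%:R ^+ s * B
  + zsign R b' ^+ M.+1 / M.+1%:R ^+ s' * (A * K)
  + (zsign R b ^+ M.+1 * zsign R b' ^+ M.+1) / (M.+1%:R ^+ s * M.+1%:R ^+ s') * K).
  by rewrite invfM; ring.
by rewrite AB /=; ring.
Qed.

End Stuffle.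

(** * Polynomial asymptotic expansions in a variable tending to infinity *)

Section PolynomialExpansion.
Variables (R : realType) (T : Type) (F : set_system T).
Context {FF : ProperFilter F}.
Variable L : T -> R.
Hypothesis L_pinfty : L @ F --> +oo.
Implicit Types (f g : T -> R) (P Q : {poly R}).

(* The error is required to beat every power of [L]: unlike mere convergence of
   [f - P(L)] to [0], this is stable under products. *)
Definition expands f P := forall n,
  (fun t => (f t - P.[L t]) * L t ^+ n) @ F --> (0 : R).

Lemma expands_cvg f P : expands f P -> (fun t => f t - P.[L t]) @ F --> (0 : R).
Proof. by move=> /(_ 0%N); under eq_fun do rewrite expr0 mulr1. Qed.

Lemma cvg0D f g : f @ F --> (0 : R) -> g @ F --> (0 : R) ->
  (fun t => f t + g t) @ F --> (0 : R).
Proof. by move=> hf hg; rewrite -[X in _ --> X](addr0 0); exact: cvgD. Qed.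

Lemma cvg0Z (c : R) f : f @ F --> (0 : R) -> (fun t => c * f t) @ F --> (0 : R).
Proof. by move=> hf; rewrite -[X in _ --> X](mulr0 c); exact: cvgZr. Qed.

Lemma cvg_sum0 (I : Type) (r : seq I) (f : I -> T -> R) :
  (forall i, f i @ F --> (0 : R)) ->
  (fun t => \sum_(i <- r) f i t) @ F --> (0 : R).
Proof.
move=> h; elim: r => [|i r IH].
  by under eq_fun do rewrite big_nil; exact: cvg_cst.
under eq_fun do rewrite big_cons.
exact: cvg0D.
Qed.

Lemma expands_horner f P Q : expands f P ->
  (fun t => (f t - P.[L t]) * Q.[L t]) @ F --> (0 : R).
Proof.
move=> h; under eq_fun do rewrite (horner_coef Q) mulr_sumr.
under eq_fun do under eq_bigr do rewrite mulrCA.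
apply: cvg_sum0 => i.
exact: cvg0Z.
Qed.

Lemma expands_eq f g P : f =1 g -> expands f P -> expands g P.
Proof. by move=> /funext <-. Qed.

Lemma expands_near_eq f g P : (\forall t \near F, f t = g t) ->
  expands f P -> expands g P.
Proof.
move=> fg h n; apply: cvg_trans (h n); apply: near_eq_cvg.
by near=> t; congr ((_ - _) * _); near: t.
Unshelve. all: by end_near. Qed.

Lemma expands_poly P : expands (fun t => P.[L t]) P.
Proof. by move=> n; under eq_fun do rewrite subrr mul0r; exact: cvg_cst. Qed.

Lemma expandsD f g P Q : expands f P -> expands g Q ->
  expands (fun t => f t + g t) (P + Q).
Proof.
move=> hf hg n; under eq_fun do rewrite hornerD opprD addrACA mulrDl.
exact: cvg0D.
Qed.

Lemma expands_sum (I : eqType) (r : seq I) (f : I -> T -> R) (P : I -> {poly R}) :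
  (forall i, i \in r -> expands (f i) (P i)) ->
  expands (fun t => \sum_(i <- r) f i t) (\sum_(i <- r) P i).
Proof.
elim: r => [|i r IH] h.
  rewrite big_nil; apply: (expands_eq _ (expands_poly 0)) => t.
  by rewrite big_nil horner0.
have hr : expands (fun t => \sum_(i <- r) f i t) (\sum_(i <- r) P i).
  by apply: IH => j jr; apply: h; rewrite inE jr orbT.
rewrite big_cons; apply: (expands_eq _ (expandsD (h i (mem_head _ _)) hr)) => t.
by rewrite big_cons.
Qed.

Lemma expandsM f g P Q : expands f P -> expands g Q ->
  expands (fun t => f t * g t) (P * Q).
Proof.
move=> hf hg n.
(* Uses f g - P Q = (f - P) (g - Q) + (g - Q) P + (f - P) Q, the power of [L] being attached to one
   factor of each term. *)
have -> : (fun t => (f t * g t - (P * Q).[L t]) * L t ^+ n) =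
    (fun t => (f t - P.[L t]) * L t ^+ n * ((g t - Q.[L t]) * L t ^+ 0)
      + ((g t - Q.[L t]) * (P * 'X^n).[L t] + (f t - P.[L t]) * (Q * 'X^n).[L t])).
  by apply/funext => t; rewrite !hornerM hornerXn; ring.
apply: cvg0D; last by apply: cvg0D; exact: expands_horner.
by rewrite -[X in _ --> X](mulr0 0); apply: cvgM.
Qed.

Lemma expandsZ (c : R) f P : expands f P -> expands (fun t => c * f t) (c *: P).
Proof.
move=> /(expandsM (expands_poly c%:P)); rewrite mul_polyC; apply: expands_eq => t.
by rewrite hornerC.
Qed.

(** Up to sign the leading coefficient is positive, and a nonzero polynomial eventually stays above
    it, so it cannot tend to 0. *)
Lemma poly_cvg0 P : (fun t => P.[L t]) @ F --> (0 : R) -> P = 0.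
Proof.
move=> h; apply/eqP/negPn/negP => P0.
wlog lP : P h P0 / 0 < lead_coef P.
  move=> W; have : lead_coef P != 0 by rewrite lead_coef_eq0.
  case: ltgtP => // lP _; last exact: W lP.
  apply: (W (- P)); rewrite ?oppr_eq0 ?lead_coefN ?oppr_gt0 //.
  by under eq_fun do rewrite hornerN -mulN1r; exact: cvg0Z.
have [x hx] := polyrcf.poly_pinfty_gt_lc lP.
near F => t.
have : `|P.[L t]| < lead_coef P by near: t; apply: cvgr0_norm_lt.
apply/negP; rewrite -leNgt (le_trans _ (ler_norm _)) // hx //.
by near: t; move/cvgryPge : L_pinfty => /(_ x).
Unshelve. all: by end_near. Qed.

(** Only plain convergence is assumed, since that is what is known of the polynomials chosen in
    [zeta_st] and [zeta_sh]. *)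
Lemma expands_weak_unique f P Q : (fun t => f t - P.[L t]) @ F --> (0 : R) ->
  (fun t => f t - Q.[L t]) @ F --> (0 : R) -> P = Q.
Proof.
move=> hP hQ; apply/eqP; rewrite -subr_eq0; apply/eqP/poly_cvg0.
have -> : (fun t => (P - Q).[L t]) = (fun t => (f t - Q.[L t]) - (f t - P.[L t])).
  by apply/funext => t; rewrite !hornerE; ring.
by rewrite -[X in _ --> X](subr0 0); apply: cvgB.
Qed.

Lemma expands_unique f P Q : expands f P -> expands f Q -> P = Q.
Proof. by move=> /expands_cvg h /expands_cvg; exact: expands_weak_unique. Qed.

Lemma cvg_expR_pow n : (fun t => expR (- (L t / 2)) * L t ^+ n) @ F --> (0 : R).
Proof.
(* From exp(y) >= y at y = L / (2 (n + 1)), raised to the power n + 1: exp(L / 2) >= L^(n + 1) /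
   K. *)
pose K : R := (2 * n.+1%:R) ^+ n.+1.
have LV : (fun t => (L t)^-1) @ F --> (0 : R).
  apply/gtr0_cvgV0 => //; near=> t.
  by near: t; move/cvgryPgt : L_pinfty => /(_ 0).
apply: (squeeze_cvgr (f := fun=> 0) (h := fun t => K * (L t)^-1)); last 2 first.
- exact: cvg_cst.
- exact: cvg0Z.
near=> t.
have L0 : 0 < L t by near: t; move/cvgryPgt : L_pinfty => /(_ 0).
have n0 : 0 < 2 * n.+1%:R :> R by rewrite mulr_gt0 // ltr0n.
apply/andP; split; first by rewrite mulr_ge0 ?expR_ge0 ?exprn_ge0 // ltW.
rewrite expRN [X in X <= _]mulrC ler_pdivrMr ?expR_gt0 // mulrAC ler_pdivlMr // -exprSr.
have -> : L t / 2 = n.+1%:R * (L t / (2 * n.+1%:R)).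
  by field; rewrite addrC natr1 gt_eqF ?ltr0n.
rewrite expRM_natl /K -exprMn ler_pXn2r ?nnegrE ?mulr_ge0 ?expR_ge0 ?(ltW L0) ?(ltW n0) //.
rewrite -ler_pdivrMl // [X in X <= _]mulrC (le_trans _ (expR_ge1Dx _)) //.
by rewrite lerDr ler01.
Unshelve. all: by end_near. Qed.

(** One criterion for both regularizations: exp(- L / 2) is M^(-1/2) up to a constant on one side
    and the square root of [eps] on the other, where a factor 1 + L is lost. *)
Lemma expands0_bound f (C : R) :
  (\forall t \near F, `|f t| <= C * (expR (- (L t / 2)) * (1 + L t))) ->
  expands f 0.
Proof.
move=> h n; apply: norm_cvg0.
apply: (squeeze_cvgr (f := fun=> 0) (h := fun t =>
  C * (expR (- (L t / 2)) * L t ^+ n + expR (- (L t / 2)) * L t ^+ n.+1))).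
- near=> t; rewrite normr_ge0 /= horner0 subr0 normrM.
  have L0 : 0 <= L t by near: t; move/cvgryPge : L_pinfty => /(_ 0).
  have Ln : 0 <= L t ^+ n by rewrite exprn_ge0.
  rewrite (ger0_norm Ln).
  have ht : `|f t| <= C * (expR (- (L t / 2)) * (1 + L t)) by near: t; exact: h.
  apply: le_trans (ler_wpM2r Ln ht) _.
  by rewrite exprS le_eqVlt; apply/orP; left; apply/eqP; ring.
- exact: cvg_cst.
- by apply: cvg0Z; apply: cvg0D; exact: cvg_expR_pow.
Unshelve. all: by end_near. Qed.

End PolynomialExpansion.

(** * Power series on the interval from -1 to 1 *)

Section PowerSeries.
Variable R : realType.
Implicit Types (c d : nat -> R) (a x : R).

Definition psv c x : R := limn (pseries c x).

Definition unit_radius c := forall x, `|x| < 1 -> cvgn (pseries c x).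

Lemma cvg_pseries_bounded c (z K x : R) :
  0 < z -> (forall n, `|c n| * z ^+ n <= K) -> `|x| < z -> cvgn (pseries c x).
Proof.
move=> z0 hK xz; apply: normed_cvg.
have K0 : 0 <= K by apply: le_trans (hK 0%N); rewrite mulr_ge0 ?exprn_ge0 // ltW.
have q1 : `|(`|x|) / z| < 1.
  by rewrite normrM normr_id normfV (gtr0_norm z0) ltr_pdivrMr ?mul1r.
apply: (series_le_cvg _ _ _ (is_cvg_geometric_series (a := K) q1)) => n /=.
- exact: normr_ge0.
- by rewrite mulr_ge0 // exprn_ge0 // divr_ge0 // ltW.
- rewrite normrM normrX expr_div_n mulrA mulrAC ler_wpM2r ?exprn_ge0 //.
  by rewrite ler_pdivlMr ?exprn_gt0.
Qed.

(** Each of the n + 1 terms of 1 + t + ... + t^n is at least t^n, and the whole sum is at most 1 /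
    (1 - t). *)
Lemma natS_exp_le (t : R) n : 0 <= t -> t < 1 -> n.+1%:R * t ^+ n <= (1 - t)^-1.
Proof.
move=> t0 t1; have ht : 0 < 1 - t by rewrite subr_gt0.
have geo m : (1 - t) * \sum_(0 <= i < m) t ^+ i = 1 - t ^+ m.
  elim: m => [|m IH]; first by rewrite big_geq // mulr0 expr0 subrr.
  by rewrite big_nat_recr //= mulrDr IH exprS; ring.
have {}geo m : (1 - t) * \sum_(0 <= i < m) t ^+ i <= 1.
  by rewrite geo gerBl exprn_ge0.
rewrite -div1r ler_pdivlMr // mulrC (le_trans _ (geo n.+1)) // ler_pM2l //.
rewrite mulr_natl -[X in _ *+ X]subn0 -sumr_const_nat; apply: ler_sum_nat => i /= hi.
by rewrite ler_wiXn2l // ltW.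
Qed.

Lemma unit_radius_linear c C : (forall n, `|c n| <= C * n.+1%:R) -> unit_radius c.
Proof.
move=> h x x1; pose z := (1 + `|x|) / 2.
have x0 := normr_ge0 x.
have C0 : 0 <= C by have := le_trans (normr_ge0 _) (h 0%N); rewrite mulr1.
apply: (@cvg_pseries_bounded c z (C * (1 - z)^-1)); rewrite /z; try lra.
move=> n; have z0 : 0 <= z by rewrite /z; lra.
rewrite (le_trans (ler_wpM2r (exprn_ge0 _ z0) (h n))) // -mulrA ler_wpM2l //.
by rewrite natS_exp_le // /z; lra.
Qed.

Lemma unit_radius_diffs c : unit_radius c -> unit_radius (pseries_diffs c).
Proof.
(* The points |x| < z < y < 1 are equally spaced. Convergence at [y] bounds the coefficients, and (z
   / y)^n absorbs the factor n + 1 of the derivative. *)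
move=> h x x1; pose z := (1 + 2 * `|x|) / 3; pose y := (2 + `|x|) / 3.
have x0 := normr_ge0 x.
have y0 : 0 < y by rewrite /y; lra.
have z0 : 0 < z by rewrite /z; lra.
have yV : 0 <= y^-1 by rewrite invr_ge0 ltW.
have zy0 : 0 <= z / y by rewrite mulr_ge0 // ltW.
have zy : z / y < 1 by rewrite ltr_pdivrMr // mul1r /z /y; lra.
have [|M [_ /(_ (M + 1))]] := @cvg_series_bounded _ _ (h y _).
  by rewrite gtr0_norm // /y; lra.
rewrite ltrDl ltr01 => /(_ isT) hM.
have {}hM n : `|c n| * y ^+ n <= M + 1.
  by have := hM n I; rewrite /= normrM normrX (gtr0_norm y0).
have M0 : 0 <= M + 1 by apply: le_trans (hM 0%N); rewrite mulr_ge0 // exprn_ge0 // ltW.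
apply: (@cvg_pseries_bounded _ z ((M + 1) * (y^-1 * (1 - z / y)^-1))) => //; last first.
  by rewrite /z; lra.
move=> n; rewrite /pseries_diffs normrM ger0_norm ?ler0n //.
have -> : n.+1%:R * `|c n.+1| * z ^+ n =
    (`|c n.+1| * y ^+ n.+1) * (y^-1 * (n.+1%:R * (z / y) ^+ n)).
  rewrite [(z / y) ^+ n]expr_div_n exprS; have := expf_neq0 n (lt0r_neq0 y0).
  by move: (y ^+ n) (z ^+ n) => Y Z Y0; field; rewrite Y0 lt0r_neq0.
apply: ler_pM => //; first by rewrite mulr_ge0 // exprn_ge0 // ltW.
  by rewrite mulr_ge0 // mulr_ge0 ?ler0n // exprn_ge0.
by rewrite ler_wpM2l // natS_exp_le.
Qed.

Lemma unit_radius_shift c : unit_radius c -> unit_radius (fun n => c n.+1).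
Proof.
move=> h x x1; pose z := (1 + `|x|) / 2; have x0 := normr_ge0 x.
have z0 : 0 < z by rewrite /z; lra.
have [|M [_ /(_ (M + 1))]] := @cvg_series_bounded _ _ (h z _).
  by rewrite gtr0_norm // /z; lra.
rewrite ltrDl ltr01 => /(_ isT) hM.
apply: (@cvg_pseries_bounded _ z ((M + 1) / z)) => //; last by rewrite /z; lra.
move=> n; rewrite ler_pdivlMr // -mulrA -exprSr.
by have := hM n.+1 I; rewrite /= normrM normrX (gtr0_norm z0).
Qed.

Lemma psv_derive c x : unit_radius c -> `|x| < 1 ->
  is_derive x (1 : R) (psv c) (psv (pseries_diffs c) x).
Proof.
move=> h x1; have x0 := normr_ge0 x; pose y := (1 + `|x|) / 2.
have y1 : `|y| < 1 by rewrite gtr0_norm // /y; lra.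
apply: (@pseries_snd_diffs _ c y).
- exact: h.
- exact: unit_radius_diffs.
- by apply: unit_radius_diffs => //; exact: unit_radius_diffs.
- by rewrite [X in _ < X]gtr0_norm // /y; lra.
Qed.

Lemma psv_cvg c x : unit_radius c -> `|x| < 1 -> pseries c x @ \oo --> psv c x.
Proof. by move=> h x1; exact: h. Qed.

Lemma pseriesD c d x :
  pseries (fun n => c n + d n) x = (fun n => pseries c x n + pseries d x n).
Proof.
apply/funext => n; rewrite /pseries /series /= -big_split /=.
by apply: eq_bigr => i _; rewrite mulrDl.
Qed.

Lemma pseriesZ a c x : pseries (fun n => a * c n) x = (fun n => a * pseries c x n).
Proof.
apply/funext => n; rewrite /pseries /series /= mulr_sumr.
by apply: eq_bigr => i _; rewrite mulrA.
Qed.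

Lemma unit_radiusD c d : unit_radius c -> unit_radius d ->
  unit_radius (fun n => c n + d n).
Proof.
move=> hc hd x x1; rewrite pseriesD; apply: is_cvgD; [exact: hc|exact: hd].
Qed.

Lemma unit_radiusZ a c : unit_radius c -> unit_radius (fun n => a * c n).
Proof.
move=> hc x x1; rewrite pseriesZ; apply: is_cvgM; [exact: is_cvg_cst|exact: hc].
Qed.

Lemma psvD c d x : unit_radius c -> unit_radius d -> `|x| < 1 ->
  psv (fun n => c n + d n) x = psv c x + psv d x.
Proof.
by move=> hc hd x1; apply: cvg_lim => //; rewrite pseriesD; apply: cvgD; exact: psv_cvg.
Qed.

Lemma psvZ a c x : unit_radius c -> `|x| < 1 ->
  psv (fun n => a * c n) x = a * psv c x.
Proof.
by move=> hc x1; apply: cvg_lim => //; rewrite pseriesZ; apply: cvgMr; exact: psv_cvg.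
Qed.

Lemma psv_shift c x : unit_radius c -> unit_radius (fun n => c n.+1) -> `|x| < 1 ->
  psv c x = c 0%N + x * psv (fun n => c n.+1) x.
Proof.
move=> hc hd x1; apply: cvg_lim => //; rewrite -cvg_shiftS.
have -> : (fun n => pseries c x n.+1) = (fun n => c 0%N + x * pseries (fun n => c n.+1) x n).
  apply/funext => n; rewrite /pseries /series /= big_nat_recl // expr0 mulr1 mulr_sumr.
  by congr (_ + _); apply: eq_bigr => i _; rewrite exprS mulrCA.
by apply: cvgD; [exact: cvg_cst|apply: cvgMr; exact: psv_cvg].
Qed.

Lemma psv_le c d x : unit_radius c -> unit_radius d -> 0 <= x -> x < 1 ->
  (forall n, c n <= d n) -> psv c x <= psv d x.
Proof.
move=> hc hd x0 x1 h; have xn : `|x| < 1 by rewrite ger0_norm.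
apply: ler_lim; [exact: hc|exact: hd|near=> n].
by apply: ler_sum => i _; rewrite ler_wpM2r ?exprn_ge0.
Unshelve. all: by end_near. Qed.

(** The identity is exact for finite sums once the one multiplied by [x] is taken one index
    behind. *)
Lemma psv_partial_sums c A x : unit_radius c -> unit_radius A -> `|x| < 1 ->
  A 0%N = c 0%N -> (forall n, A n.+1 = A n + c n.+1) ->
  psv c x = (1 - x) * psv A x.
Proof.
move=> hc hA x1 A0 AS; apply: cvg_lim => //; rewrite -cvg_shiftS.
have -> : (fun n => pseries c x n.+1) = (fun n => pseries A x n.+1 - x * pseries A x n).
  have pS d n : pseries d x n.+1 = pseries d x n + d n * x ^+ n.
    by rewrite /pseries seriesSr.
  have p0 d : pseries d x 0%N = 0 by rewrite /pseries /series /= big_geq.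
  apply/funext; elim=> [|n IH]; first by rewrite !pS !p0 A0; ring.
  by rewrite pS IH !pS AS exprS; ring.
rewrite mulrBl mul1r; apply: cvgB; first by rewrite cvg_shiftS; exact: psv_cvg.
by apply: cvgMr; exact: psv_cvg.
Qed.

Lemma psv0 c : psv c 0 = c 0%N.
Proof.
apply: cvg_lim => //; rewrite -cvg_shiftS.
have -> : (fun n => pseries c 0 n.+1) = cst (c 0%N); last exact: cvg_cst.
apply/funext => n; rewrite /pseries /series /= big_nat_recl // expr0 mulr1.
by rewrite big1 ?addr0 // => i _; rewrite exprS mul0r mulr0.
Qed.

(** The derivatives are compared only at positive points, because the letter [dt/t] is singular at
    0. *)
Lemma eq_of_derive (f g df dg : R -> R) :
  (forall x, `|x| < 1 -> is_derive x (1 : R) f (df x)) ->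
  (forall x, `|x| < 1 -> is_derive x (1 : R) g (dg x)) ->
  (forall x, 0 < x -> x < 1 -> df x = dg x) -> f 0 = g 0 ->
  forall x, 0 <= x -> x < 1 -> f x = g x.
Proof.
move=> hf hg hd fg0 x; rewrite le_eqVlt => /predU1P[<- //|x0] x1.
have hfg y : `|y| < 1 -> is_derive y (1 : R) (f - g) (df y - dg y).
  by move=> y1; have := hf y y1; have := hg y y1 => ? ?; exact: is_deriveB.
have [||c] := @MVT R (f - g) (fun y => df y - dg y) 0 x x0.
- move=> y; rewrite in_itv /= => /andP[y0 yx]; apply: hfg.
  by rewrite ger0_norm ?ltW // (lt_trans yx).
- apply: derivable_within_continuous => y; rewrite in_itv /= => /andP[y0 yx].
  by have /hfg[] : `|y| < 1 by rewrite ger0_norm // (le_lt_trans yx).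
rewrite in_itv /= => /andP[c0 cx]; rewrite hd ?(lt_trans cx) // subrr mul0r.
rewrite !fctE /= fg0 subrr subr0 => /eqP; rewrite subr_eq0 => /eqP //.
Qed.

End PowerSeries.

(** * Iterated integrals as power series, and their shuffle product *)

Section IteratedIntegrals.
Variable R : realType.
Implicit Types (w : seq (option R)) (k : idx) (x : R).

(* Taylor coefficients at [0] of [itint w]; the division by [n] makes the
   constant term of a nonempty word [0]. *)
Fixpoint wcoef w (n : nat) : R :=
  match w with
  | [::] => (n == 0)%:R
  | None :: w' => wcoef w' n / n%:R
  | Some a :: w' => (\sum_(0 <= m < n) a ^+ (n - m) * wcoef w' m) / n%:R
  end.

(* Words with letters [dt/t], [dt/(1-t)], [dt/(-1-t)] not ending in [dt/t]. *)
Fixpoint admissible w : bool :=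
  match w with
  | [::] => true
  | None :: w' => (w' != [::]) && admissible w'
  | Some a :: w' => (a ^+ 2 == 1) && admissible w'
  end.

Lemma norm_sqr1 (a : R) n : a ^+ 2 == 1 -> `|a ^+ n| = 1.
Proof. by rewrite sqrf_eq1 => /orP[] /eqP ->; rewrite normrX ?normrN normr1 expr1n. Qed.

Lemma wcoef_le1 w n : admissible w -> `|wcoef w n| <= 1.
Proof.
elim: w n => [|[a|] w IH] n /=.
- by move=> _; rewrite ger0_norm ?ler0n // lern1 leq_b1.
- case/andP => a1 gw; case: n => [|n]; first by rewrite invr0 mulr0 normr0.
  rewrite normrM normfV normr_nat ler_pdivrMr ?ltr0n // mul1r.
  rewrite (le_trans (ler_norm_sum _ _ _)) //.
  rewrite -[X in _ <= X%:R]subn0 -[X in _ <= X]sumr_const_nat; apply: ler_sum => m _.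
  by rewrite normrM norm_sqr1 // mul1r IH.
- case/andP => _ gw; case: n => [|n]; first by rewrite invr0 mulr0 normr0.
  rewrite normrM normfV normr_nat ler_pdivrMr ?ltr0n // mul1r.
  by rewrite (le_trans (IH _ gw)) // ler1n.
Qed.

Lemma wcoef0 f w : wcoef (f :: w) 0 = 0.
Proof. by case: f => [a|] /=; rewrite invr0 mulr0. Qed.

Lemma wcoef_radius w : admissible w -> unit_radius (wcoef w).
Proof.
move=> gw; apply: (@unit_radius_linear _ _ 1) => n.
by rewrite mul1r (le_trans (wcoef_le1 _ gw)) // ler1n.
Qed.

Lemma admissible_behead f w : admissible (f :: w) -> admissible w.
Proof. by case: f => [a|] /= /andP[]. Qed.

(** For [dt/(a - t)] the denominator is cleared: since a^2 = 1, the coefficients [D] of the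
    derivative satisfy a D_(n+1) = w_(n+1) + D_n, which says (a - x) D(x) = w(x). *)
Lemma wcoef_diffs_horner f w x : admissible (f :: w) -> 0 < x -> x < 1 ->
  psv (pseries_diffs (wcoef (f :: w))) x = form_val f x * psv (wcoef w) x.
Proof.
move=> gfw x0 x1; have xn : `|x| < 1 by rewrite gtr0_norm.
have gw := admissible_behead gfw.
have rD := unit_radius_diffs (wcoef_radius gfw).
have rw := wcoef_radius gw; have rw' := unit_radius_shift rw.
case: f gfw rD => [a|] /= /andP[ha _] rD.
- set D := pseries_diffs _ in rD *.
  have DE n : D n = \sum_(0 <= m < n.+1) a ^+ (n.+1 - m) * wcoef w m.
    by rewrite /D /pseries_diffs /= mulrC mulfVK // pnatr_eq0.
  have aa : a * a = 1 by rewrite -expr2; apply/eqP.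
  have aD0 : a * D 0%N = wcoef w 0 by rewrite DE big_nat1 mulrA aa mul1r.
  have aDS n : a * D n.+1 = wcoef w n.+1 + D n.
    rewrite DE big_nat_recr //= subSnn expr1 mulrDr mulrA aa mul1r addrC; congr (_ + _).
    rewrite DE mulr_sumr; apply: eq_big_nat => m /= hm.
    by rewrite (subSn (ltnW hm)) exprS !mulrA aa mul1r.
  have rDS := unit_radius_shift rD.
  have ax : a - x != 0.
    move: ha; rewrite sqrf_eq1 => /orP[] /eqP ->; last by rewrite lt_eqF //; lra.
    by rewrite gt_eqF //; lra.
  apply: (mulfI ax); rewrite mulrA mulfV // mul1r mulrBl.
  rewrite [psv (wcoef w) x]psv_shift //.
  have -> : a * psv D x = wcoef w 0 + x * (psv (fun n => wcoef w n.+1) x + psv D x).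
    rewrite -psvD // [in LHS]psv_shift // mulrDr aD0 mulrCA -[a * _]psvZ //.
    by congr (_ + x * psv _ x); apply/funext.
  by ring.
- rewrite [psv (wcoef w) x]psv_shift //.
  have -> : pseries_diffs (fun n => wcoef w n / n%:R) = (fun n => wcoef w n.+1).
    by apply/funext => n; rewrite /pseries_diffs mulrC mulfVK // pnatr_eq0.
  (* By admissibility a letter follows [dt/t], so the series of [w] has no constant term and can be
     divided by x. *)
  case: w ha {gw rD rw rw'} => // g w _.
  by rewrite wcoef0 add0r mulrA mulVf ?mul1r // gt_eqF.
Qed.

Lemma psv_wcoef_derive f w x : admissible (f :: w) -> `|x| < 1 ->
  is_derive x (1 : R) (psv (wcoef (f :: w))) (psv (pseries_diffs (wcoef (f :: w))) x).
Proof. by move=> g; apply: psv_derive; exact: wcoef_radius. Qed.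

Lemma psv_wcoef_nil x : `|x| < 1 -> psv (wcoef [::]) x = 1.
Proof.
move=> x1; have r := wcoef_radius (w := [::]) isT.
rewrite psv_shift //; last exact: unit_radius_shift.
have -> : (fun n => wcoef [::] n.+1) = (fun n => 0 * wcoef [::] n).
  by apply/funext => n; rewrite mul0r.
by rewrite psvZ // mul0r mulr0 addr0.
Qed.

Lemma itint_psv w x : admissible w -> 0 <= x -> x < 1 -> itint w x = psv (wcoef w) x.
Proof.
elim: w x => [|f w IH] x gw x0 x1.
  by rewrite psv_wcoef_nil // ger0_norm.
move: x0; rewrite le_eqVlt => /predU1P[<-|x0].
  by rewrite psv0 wcoef0 /= set_itv1 Rintegral_set1.
pose D := psv (pseries_diffs (wcoef (f :: w))).
have xn y : 0 <= y -> y <= x -> `|y| < 1 by move=> y0 yx; rewrite ger0_norm // (le_lt_trans yx).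
(* At 0 the factor 1/t takes the default value 0, so the integrand may differ from [D] there; the
   two are compared on the half-open interval and the endpoint is restored afterwards. *)
have eqD : {in `]0, x]%classic, D =1 (fun t => form_val f t * itint w t)}.
  move=> t; rewrite inE /= in_itv /= => /andP[t0 tx].
  have t1 := le_lt_trans tx x1.
  by rewrite /D wcoef_diffs_horner // IH ?(admissible_behead gw) // ltW.
have rD : unit_radius (pseries_diffs (wcoef (f :: w))).
  by apply: unit_radius_diffs; exact: wcoef_radius.
have cD : {within `[0, x], continuous D}.
  apply: derivable_within_continuous => y; rewrite in_itv /= => /andP[y0 yx].
  by have [] := psv_derive rD (xn y y0 yx).
have iD : lebesgue_measure.-integrable `[0, x] (EFin \o D).
  by apply: continuous_compact_integrable => //; exact: segment_compact.
have iD' : lebesgue_measure.-integrable `]0, x] (EFin \o D).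
  by apply: integrableS iD => //; apply: subset_itvr; rewrite bnd_simp.
transitivity (\int[@lebesgue_measure R]_(t in `]0, x]) (form_val f t * itint w t)).
  apply/esym/Rintegral_itv_obnd_cbnd.
  by apply: eq_integrable iD' => // t ht; rewrite /= eqD.
transitivity (\int[@lebesgue_measure R]_(t in `]0, x]) D t).
  by apply: eq_Rintegral => t ht; rewrite eqD.
transitivity (\int[@lebesgue_measure R]_(t in `[0, x]) D t).
  exact: Rintegral_itv_obnd_cbnd.
have -> : psv (wcoef (f :: w)) x = psv (wcoef (f :: w)) x - psv (wcoef (f :: w)) 0.
  by rewrite psv0 wcoef0 subr0.
rewrite /Rintegral; set I := (X in fine X); suff -> : I =
  ((psv (wcoef (f :: w)) x)%:E - (psv (wcoef (f :: w)) 0)%:E)%E by [].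
apply: (continuous_FTC2 x0 cD).
- have cF : {within `[0, x], continuous (psv (wcoef (f :: w)))}.
    apply: derivable_within_continuous => y; rewrite in_itv /= => /andP[y0 yx].
    by have [] := psv_wcoef_derive gw (xn y y0 yx).
  have [_ h1 h2] := (continuous_within_itvP _ x0).1 cF.
  split=> // y; rewrite in_itv /= => /andP[y0 yx].
  by have [] := psv_wcoef_derive gw (xn y (ltW y0) (ltW yx)).
- move=> y; rewrite in_itv /= => /andP[y0 yx]; rewrite derive1E.
  by have [_ ->] := psv_wcoef_derive gw (xn y (ltW y0) (ltW yx)).
Qed.

(* The terms of the shuffle product of [[:: f]] and [w]. *)
Fixpoint insertions (f : option R) w : seq (seq (option R)) :=
  if w is g :: w' then (f :: w) :: map (cons g) (insertions f w') else [:: [:: f]].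

Lemma insertions_neq0 f w w' : w' \in insertions f w -> w' != [::].
Proof.
case: w => [|g w] /=; first by rewrite inE => /eqP ->.
by rewrite inE => /predU1P[-> //|/mapP[? _ ->]].
Qed.

Lemma insertions_admissible (a : R) w w' : a ^+ 2 == 1 -> admissible w ->
  w' \in insertions (Some a) w -> admissible w'.
Proof.
move=> a1; elim: w w' => [|g w IH] w' gw /=.
  by rewrite inE => /eqP ->; rewrite /= a1.
rewrite inE => /predU1P[-> |/mapP[v hv ->]]; first by rewrite /= a1.
have gv := IH _ (admissible_behead gw) hv.
case: g gw => [b|] /= /andP[h1 h2]; first by rewrite h1.
by rewrite (insertions_neq0 hv).
Qed.

(** Both sides vanish at 0 when [w] is nonempty. The product rule removes the first letter of one
    factor at a time, and the induction hypothesis identifies the derivatives. *)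
Lemma psv_shuffle (a : R) w : a ^+ 2 == 1 -> admissible w ->
  forall x, 0 <= x -> x < 1 ->
  psv (wcoef [:: Some a]) x * psv (wcoef w) x =
  \sum_(w' <- insertions (Some a) w) psv (wcoef w') x.
Proof.
move=> a1; elim: w => [|g w IH] gw.
  move=> x x0 x1; rewrite big_seq1 psv_wcoef_nil ?mulr1 // ger0_norm //.
have gw' := admissible_behead gw.
have ga : admissible [:: Some a] by rewrite /= a1.
have gag : admissible [:: Some a, g & w] by rewrite /= a1.
pose d v x := psv (pseries_diffs (wcoef v)) x.
have gs v : v \in insertions (Some a) w -> admissible (g :: v).
  move=> hv; apply: (@insertions_admissible a (g :: w)) => //=.
  by rewrite inE map_f ?orbT.
have dsum s x : `|x| < 1 -> {subset s <= insertions (Some a) w} ->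
    is_derive x (1 : R) (fun x => \sum_(v <- s) psv (wcoef (g :: v)) x)
      (\sum_(v <- s) d (g :: v) x).
  move=> x1; elim: s => [|v s IHs] hs.
    rewrite big_nil (_ : (fun=> _) = cst 0); first exact: is_derive_cst.
    by apply/funext => y; rewrite big_nil.
  rewrite big_cons (_ : (fun=> _) = psv (wcoef (g :: v)) +
      (fun x => \sum_(v <- s) psv (wcoef (g :: v)) x)); last first.
    by apply/funext => y; rewrite big_cons.
  apply: is_deriveD; first by apply: psv_wcoef_derive => //; apply/gs/hs; rewrite mem_head.
  by apply: IHs => u us; apply: hs; rewrite inE us orbT.
move=> x x0 x1; apply: (@eq_of_derive R
  (fun x => psv (wcoef [:: Some a]) x * psv (wcoef (g :: w)) x)
  (fun x => \sum_(w' <- insertions (Some a) (g :: w)) psv (wcoef w') x)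
  (fun x => psv (wcoef [:: Some a]) x * d (g :: w) x +
            psv (wcoef (g :: w)) x * d [:: Some a] x)
  (fun x => d [:: Some a, g & w] x + \sum_(v <- insertions (Some a) w) d (g :: v) x)
  _ _ _ _ x x0 x1) => {x x0 x1}.
- move=> x x1; exact: (is_deriveM (psv_wcoef_derive ga x1) (psv_wcoef_derive gw x1)).
- move=> x x1; rewrite (_ : (fun=> _) = psv (wcoef [:: Some a, g & w]) +
      (fun x => \sum_(v <- insertions (Some a) w) psv (wcoef (g :: v)) x)); last first.
    by apply/funext => y; rewrite /= big_cons big_map.
  by apply: is_deriveD; [exact: psv_wcoef_derive|exact: dsum].
- move=> x x0 x1; rewrite /d !wcoef_diffs_horner // psv_wcoef_nil ?gtr0_norm //.
  rewrite (eq_big_seq (fun v => form_val g x * psv (wcoef v) x)); last first.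
    by move=> v hv; rewrite wcoef_diffs_horner // gs.
  by rewrite -mulr_sumr -IH ?(ltW x0) //; ring.
- rewrite [insertions _ _]/= big_cons big_map !psv0 !wcoef0 mul0r add0r big1 // => v _.
  by rewrite psv0 wcoef0.
Qed.

End IteratedIntegrals.

(** * Taylor coefficients of the words of Euler sums *)

Section Words.
Variable R : realType.
Implicit Types (w : seq (option R)) (k : idx) (x : R).

Lemma wcoef_nseq s w n : wcoef (nseq s None ++ w) n = wcoef w n / n%:R ^+ s.
Proof.
elim: s => [|s IH]; first by rewrite expr0 divr1.
by rewrite /= IH exprSr invfM mulrA.
Qed.

Lemma zsign_sqr b : zsign R b ^+ 2 = 1.
Proof. by case: b; rewrite /= ?sqrrN expr1n. Qed.

(** The starting sign [a] is kept general because the tail of an index is read with the partial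
    product already accumulated. *)
Lemma wcoef_word a k : a ^+ 2 = 1 -> positive_idx k ->
  wcoef (word_aux a k) 0 = ztrunc R k 0 /\
  forall n, wcoef (word_aux a k) n.+1 = a ^+ n.+1 * (ztrunc R k n.+1 - ztrunc R k n).
Proof.
elim: k a => [|[[|s] b] k IH] a a1 // pk.
  by split=> // n; rewrite subrr mulr0.
rewrite [word_aux _ _]/=; set a' := a * zsign R b.
have a'1 : a' ^+ 2 = 1 by rewrite exprMn a1 zsign_sqr mulr1.
have [h0 hS] := IH a' a'1 pk.
(* The two powers of a' cancel since a'^2 = 1, and the increments telescope. *)
have hsum n : \sum_(0 <= m < n.+1) a' ^+ m * wcoef (word_aux a' k) m = ztrunc R k n.
  elim: n => [|n IHn]; first by rewrite big_nat1 h0 mul1r.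
  rewrite big_nat_recr // IHn hS /= mulrA -exprD addnn -mul2n exprM a'1 expr1n.
  by ring.
split; first by rewrite wcoef_nseq wcoef0 mul0r ztrunc0.
move=> n; rewrite wcoef_nseq ztruncS addrAC subrr add0r -hsum [wcoef _ _]/=.
have -> : \sum_(0 <= m < n.+1) a' ^+ (n.+1 - m) * wcoef (word_aux a' k) m =
    a' ^+ n.+1 * \sum_(0 <= m < n.+1) a' ^+ m * wcoef (word_aux a' k) m.
  rewrite mulr_sumr; apply: eq_big_nat => m /= hm; rewrite mulrA; congr (_ * _).
  have -> : a' ^+ n.+1 = a' ^+ (n.+1 - m) * a' ^+ m by rewrite -exprD subnK // ltnW.
  by rewrite -mulrA -exprD addnn -mul2n exprM a'1 expr1n mulr1.
by rewrite (exprS n.+1%:R s) invfM exprMn; ring.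
Qed.

Lemma word_aux_admissible (a : R) k : a ^+ 2 = 1 -> admissible (word_aux a k).
Proof.
elim: k a => [|[s b] k IH] a a1 //=.
have a'1 : (a * zsign R b) ^+ 2 = 1 by rewrite exprMn a1 zsign_sqr mulr1.
by elim: s.-1 => [|m IHm] /=; rewrite ?a'1 ?eqxx ?IH //= IHm andbT; case: (m).
Qed.

Lemma growth_radius (A : nat -> R) : growth A -> unit_radius A.
Proof.
move=> [C h]; apply: (@unit_radius_linear _ _ C) => n.
have C0 : 0 <= C by have := le_trans (normr_ge0 _) (h 0%N); rewrite pmulr_lge0 // rt_gt0.
by rewrite (le_trans (h n)) // ler_wpM2l // -rt_sqr expr2 ler_peMl ?rt_ge1 // ltW ?rt_gt0.
Qed.

Lemma rate_growth (e : nat -> R) : rate e -> growth e.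
Proof.
move=> [C h]; exists C => n; have r0 := rt_gt0 R n.
have C0 : 0 <= C.
  by have := le_trans (normr_ge0 _) (h 0%N); rewrite pmulr_lge0 // invr_gt0 rt_gt0.
rewrite (le_trans (h n)) // ler_wpM2l // (@le_trans _ _ 1) ?rt_ge1 //.
by rewrite invf_le1 // rt_ge1.
Qed.

(* Abel summation: [itint (word k)] is the generating function of the increments
   of [ztrunc k]. *)
Lemma itint_word k x : positive_idx k -> 0 <= x -> x < 1 ->
  itint (word R k) x = (1 - x) * psv (ztrunc R k) x.
Proof.
move=> pk x0 x1; have ak := word_aux_admissible k (expr1n R 2).
have [h0 hS] := wcoef_word (expr1n R 2) pk.
rewrite itint_psv //; apply: psv_partial_sums.
- exact: wcoef_radius.
- by apply: growth_radius; exact: ztrunc_growth.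
- by rewrite ger0_norm.
- by [].
- by move=> n; rewrite hS expr1n mul1r addrC subrK.
Qed.

Lemma psv_wcoef_log x : 0 <= x -> x < 1 -> psv (wcoef [:: Some (1 : R)]) x = - ln (1 - x).
Proof.
move=> x0 x1; have g1 : admissible [:: Some (1 : R)] by rewrite /= expr1n eqxx.
apply: (@eq_of_derive R (psv (wcoef [:: Some 1])) (fun x => - ln (1 - x))
  (psv (pseries_diffs (wcoef [:: Some 1]))) (fun x => (1 - x)^-1) _ _ _ _ x x0 x1).
- by move=> y y1; exact: psv_wcoef_derive.
- move=> y y1; have y1' : 0 < 1 - y by rewrite subr_gt0 (le_lt_trans (ler_norm _)).
  have d1 : is_derive y (1 : R) (fun z : R => 1 - z) (0 - 1).
    exact: is_deriveB.
  have d2 : is_derive (1 - y) (1 : R) (@ln R) (1 - y)^-1 by exact: is_derive1_ln.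
  have := is_deriveN (is_derive1_comp (f := @ln R) (g := fun z => 1 - z) d2 d1).
  by rewrite sub0r mulrN1 opprK.
- by move=> y y0 y1; rewrite wcoef_diffs_horner // psv_wcoef_nil ?mulr1 // gtr0_norm.
- by rewrite psv0 wcoef0 subr0 ln1 oppr0.
Qed.

End Words.

(** * Expansions of truncated sums and estimates for Abel means *)

Section Regularization.
Variable R : realType.
Implicit Types (k : idx) (P Q : {poly R}).

(** The increment of ln at n + 1 lies between 1 / (n + 2) and 1 / (n + 1), whose gap is at most (n +
    1)^(-2). Starting at index 1 avoids the logarithm of 0. *)
Lemma harmonic_ln_rate :
  rate (fun n => ztrunc R [:: pos 1] n.+1 - ln (n.+1%:R : R) - euler_gamma R).
Proof.
pose H := ztrunc R [:: pos 1].
have [n|l hl] := @rate_increments R (fun n => H n.+1 - ln (n.+1%:R : R)) 1.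
  have n1 : 0 < n.+1%:R :> R by rewrite ltr0n.
  have n2 : n.+2%:R = n.+1%:R + 1 :> R by rewrite -(natr1 n.+1).
  have E1 : ln (n.+2%:R : R) - ln (n.+1%:R : R) <= n.+1%:R^-1.
    rewrite -ln_div ?posrE ?ltr0n // n2 mulrDl mulfV ?gt_eqF // mul1r.
    by apply: le_ln1Dx; rewrite (@lt_trans _ _ 0) ?invr_gt0 // ltrN10.
  have E2 : n.+2%:R^-1 <= ln (n.+2%:R : R) - ln (n.+1%:R : R).
    rewrite -lerN2 opprB -ln_div ?posrE ?ltr0n //.
    have -> : n.+1%:R / n.+2%:R = 1 + - (n.+2%:R^-1) :> R.
      by rewrite n2; field; rewrite gt_eqF //; lra.
    by apply: le_ln1Dx; rewrite ltrN2 invf_lt1 ?ltr0n // ltr1n.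
  have E3 : n.+1%:R^-1 - n.+2%:R^-1 <= 1 / rt R n ^+ 3.
    apply: (@le_trans _ _ (n.+1%:R ^+ 2)^-1).
      have -> : n.+1%:R^-1 - n.+2%:R^-1 = (n.+1%:R * n.+2%:R)^-1 :> R.
        by rewrite n2; field; rewrite !gt_eqF //; lra.
      rewrite lef_pV2 ?posrE ?mulr_gt0 ?exprn_gt0 ?ltr0n // expr2 ler_pM2l //.
      by rewrite ler_nat.
    rewrite div1r lef_pV2 ?posrE ?exprn_gt0 ?rt_gt0 // -rt_sqr -exprM.
    by rewrite ler_weXn2l ?rt_ge1.
  have -> : H n.+2 = H n.+1 + n.+2%:R^-1.
    by rewrite /H ztruncS expr1n expr1 mul1r mulr1.
  move: E1 E2 E3; move: (H n.+1) (ln _) (ln _) (n.+1%:R^-1) (n.+2%:R^-1) (1 / _).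
  by move=> h l1 l2 p q r E1 E2 E3; rewrite ler_norml; apply/andP; split; lra.
suff -> : euler_gamma R = l by [].
apply: cvg_lim => //; rewrite -cvg_shiftS.
have -> : (fun n => \sum_(1 <= j < n.+2) j%:R^-1 - ln (n.+1%:R : R)) =
    (fun n => H n.+1 - ln (n.+1%:R : R)).
  apply/funext => n; congr (_ - _); apply: eq_bigr => j _.
  by rewrite expr1n expr1 mul1r mulr1.
by apply/subr_cvg0; exact: rate_cvg0.
Qed.

Definition lnM (M : nat) : R := ln (M%:R : R) + euler_gamma R.

Lemma lnM_pinfty : lnM @ \oo --> +oo.
Proof.
apply/cvgryPge => A; near=> M.
rewrite -lerBlDr -[leLHS]expRK ler_ln ?posrE ?expR_gt0 //.
  by near: M; exact: nbhs_infty_ger.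
by rewrite ltr0n; near: M; exact: nbhs_infty_gt.
Unshelve. all: by end_near. Qed.

Lemma invrt_lnM n : (rt R n)^-1 = expR (euler_gamma R / 2) * expR (- (lnM n.+1 / 2)).
Proof.
rewrite -expRD /lnM.
have -> : euler_gamma R / 2 - (ln n.+1%:R + euler_gamma R) / 2 = - (ln (n.+1%:R : R) / 2).
  by ring.
rewrite expRN; congr (_^-1).
have : expR (ln (n.+1%:R : R) / 2) ^+ 2 = rt R n ^+ 2.
  rewrite rt_sqr -expRM_natl mulrCA mulfV ?mulr1 ?lnK ?posrE ?ltr0n //.
move/eqP; rewrite eqf_sqr => /predU1P[-> //|/eqP h].
by have := expR_gt0 (ln (n.+1%:R : R) / 2); rewrite h oppr_gt0 ltNge (ltW (rt_gt0 R n)).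
Qed.

Lemma expands_rateS (e : nat -> R) : rate (fun n => e n.+1) -> expands \oo lnM e 0.
Proof.
move=> [C h]; apply: (@expands0_bound _ _ _ _ _ lnM_pinfty _ (C * expR (euler_gamma R / 2))).
near=> M; have : (0 < M)%N by near: M; exact: nbhs_infty_gt.
case EM : M => [//|n] _; rewrite -EM.
have L0 : 0 <= lnM M by near: M; move/cvgryPge : lnM_pinfty => /(_ 0).
rewrite EM in L0 *; apply: le_trans (h n) _; rewrite invrt_lnM mulrA.
rewrite [leRHS]mulrA ler_peMr ?lerDl // mulr_ge0 ?expR_ge0 //.
have C0 : 0 <= C.
  by have := le_trans (normr_ge0 _) (h 0%N); rewrite pmulr_lge0 // invr_gt0 rt_gt0.
by rewrite mulr_ge0 ?expR_ge0.
Unshelve. all: by end_near. Qed.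

Lemma expands_rate (e : nat -> R) : rate e -> expands \oo lnM e 0.
Proof.
move=> [C h]; apply: expands_rateS; exists C => n.
have C0 : 0 <= C.
  by have := le_trans (normr_ge0 _) (h 0%N); rewrite pmulr_lge0 // invr_gt0 rt_gt0.
rewrite (le_trans (h n.+1)) // ler_wpM2l // lef_pV2 ?posrE ?rt_gt0 //.
exact: rt_leS.
Qed.

Lemma expands_harmonic : expands \oo lnM (ztrunc R [:: pos 1]) 'X.
Proof.
have h : expands \oo lnM (fun M => ztrunc R [:: pos 1] M - lnM M) 0.
  apply: expands_rateS; have := harmonic_ln_rate; congr rate.
  by apply/funext => n; rewrite /lnM; ring.
rewrite -['X]add0r; apply: (expands_eq _ (expandsD h (expands_poly _ _))) => M.
by rewrite hornerX subrK.
Qed.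

Lemma expands_convergent k : positive_idx k -> convergent_idx k ->
  expands \oo lnM (ztrunc R k) (zeta R k)%:P.
Proof.
move=> pk ck; have h := expands_rate (zeta_rate R pk ck).
rewrite -[_%:P]add0r; apply: (expands_eq _ (expandsD h (expands_poly _ _))) => M.
by rewrite hornerC subrK.
Qed.

(* [H_M^2 = 2 ztrunc [1, 1] M + ztrunc [2] M]. *)
Lemma expands_ones : expands \oo lnM (ztrunc R [:: pos 1; pos 1])
  (2^-1 *: ('X ^+ 2 - (zeta R [:: pos 2])%:P)).
Proof.
have h2 : expands \oo lnM (fun M => -1 * ztrunc R [:: pos 2] M)
    (-1 *: (zeta R [:: pos 2])%:P).
  by apply: expandsZ; exact: expands_convergent.
rewrite -scaleN1r expr2; apply: (expands_eq _ (expandsZ 2^-1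
  (expandsD (expandsM expands_harmonic expands_harmonic) h2))) => M.
rewrite ztrunc_stuffle1 [stuffle1 _ _]/= !big_cons big_nil -/(pos 2).
by field.
Qed.

Lemma expands_ztrunc k c d (r : R) : expansion k c d r ->
  expands \oo lnM (ztrunc R k) (c%:P + d *: 'X
    + r *: (2^-1 *: ('X ^+ 2 - (zeta R [:: pos 2])%:P))).
Proof.
move=> /expands_rate h.
rewrite -[X in expands _ _ _ X]add0r; apply: (expands_eq _ (expandsD h
  (expandsD (expandsD (expands_poly _ c%:P) (expandsZ d expands_harmonic))
  (expandsZ r expands_ones)))) => M.
by rewrite hornerC subrK.
Qed.

Definition lnV (eps : R) : R := - ln eps.

Lemma lnV_pinfty : lnV @ 0^'+ --> +oo.
Proof.
apply/cvgryPge => A; near=> eps; rewrite /lnV lerNr -[leRHS]expRK.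
have e0 : 0 < eps by near: eps; exact: nbhs_right_gt.
rewrite ler_ln ?posrE ?expR_gt0 // ltW //.
by near: eps; apply: nbhs_right_lt; exact: expR_gt0.
Unshelve. all: by end_near. Qed.

(** Expands the square of t - 1 / [rt n]. It replaces n^(-1/2) by a combination of 1 and 1/n, whose
    generating series are explicit. *)
Lemma invrt_amgm n (t : R) : 0 < t -> (rt R n)^-1 <= 2^-1 * (t + t^-1 * n.+1%:R^-1).
Proof.
move=> t0; rewrite -(rt_sqr R n); have r0 := rt_gt0 R n.
have : 0 <= (t - (rt R n)^-1) ^+ 2 * t^-1 by rewrite mulr_ge0 ?sqr_ge0 // invr_ge0 ltW.
have -> : (t - (rt R n)^-1) ^+ 2 * t^-1 =
    t + t^-1 * (rt R n ^+ 2)^-1 - 2 * (rt R n)^-1.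
  by field; rewrite !gt_eqF.
by rewrite subr_ge0 ler_pdivlMl.
Qed.

Lemma psv_inv_log (x : R) : 0 <= x -> x < 1 -> x * psv (fun n => n.+1%:R^-1) x = - ln (1 - x).
Proof.
move=> x0 x1; have x1' : `|x| < 1 by rewrite ger0_norm.
have g1 : admissible [:: Some (1 : R)] by rewrite /= expr1n eqxx.
have r1 := wcoef_radius g1.
rewrite -psv_wcoef_log // [RHS]psv_shift //; last exact: unit_radius_shift.
rewrite wcoef0 add0r; congr (_ * psv _ _); apply/funext => n /=.
rewrite big_nat_recl // big1 ?addr0 => [|i _]; last by rewrite mulr0.
by rewrite expr1n !mul1r.
Qed.

(** [invrt_amgm] with t the square root of [eps] bounds the mean by C / 2 times t (1 + S), where S
    is the series of 1 / (n + 1) at 1 - eps; S is at most 2 [lnV eps]. *)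
Lemma expands_abel_rate (e : nat -> R) : rate e ->
  expands 0^'+ lnV (fun eps => eps * psv e (1 - eps)) 0.
Proof.
move=> re; have re' := growth_radius (rate_growth re); case: re => C h.
have C0 : 0 <= C.
  by have := le_trans (normr_ge0 _) (h 0%N); rewrite pmulr_lge0 // invr_gt0 rt_gt0.
apply: (@expands0_bound _ _ _ _ _ lnV_pinfty _ C); near=> eps.
have e0 : 0 < eps by near: eps; exact: nbhs_right_gt.
(* This keeps x above 1/2, so that x S = [lnV eps] yields S <= 2 [lnV eps]. *)
have e2 : eps < 2^-1 by near: eps; apply: nbhs_right_lt; rewrite invr_gt0.
have L0 : 0 <= lnV eps by near: eps; move/cvgryPge : lnV_pinfty => /(_ 0).
set t := expR (- (lnV eps / 2)).
have t0 : 0 < t := expR_gt0 _.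
have tt : t * t = eps.
  rewrite -expRD -[RHS]lnK ?posrE //; congr expR; rewrite /lnV.
  by field.
set x := 1 - eps; have x0 : 0 <= x by rewrite /x; lra.
have x1 : x < 1 by rewrite /x; lra.
have x1' : `|x| < 1 by rewrite ger0_norm.
have r1 : unit_radius (fun=> 1 : R).
  by apply: growth_radius; exists 1 => n; rewrite normr1 mul1r rt_ge1.
have ri : unit_radius (fun n => n.+1%:R^-1 : R).
  apply: (@unit_radius_linear _ _ 1) => n; rewrite mul1r ger0_norm ?invr_ge0 ?ler0n //.
  by rewrite (@le_trans _ _ 1) ?ler1n // invf_le1 ?ler1n ?ltr0n.
have p1 : eps * psv (fun=> 1) x = 1.
  by have := @itint_word R [::] x isT x0 x1; rewrite /= {1}/x subKr => <-.
have pi : psv (fun n => n.+1%:R^-1) x <= 2 * lnV eps.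
  have := psv_inv_log x0 x1; rewrite {2}/x subKr -/(lnV eps).
  have : 0 <= psv (fun n => n.+1%:R^-1) x.
    have -> : 0 = psv (fun=> 0 * (1 : R)) x by rewrite psvZ // mul0r.
    apply: psv_le => //; first exact: unit_radiusZ.
    by move=> n; rewrite mul0r invr_ge0 ler0n.
  by move=> h0 h1; rewrite /x in h1; nra.
pose b n : R := C * 2^-1 * (t * 1 + t^-1 * n.+1%:R^-1).
have rt1 : unit_radius (fun n => t * 1 + t^-1 * n.+1%:R^-1).
  by apply: unit_radiusD; exact: unit_radiusZ.
have rb : unit_radius b := unit_radiusZ rt1.
have eb n : `|e n| <= b n.
  rewrite (le_trans (h n)) // /b -mulrA ler_wpM2l // mulr1; exact: invrt_amgm.
have bE : psv b x = C * 2^-1 * (t * psv (fun=> 1) x + t^-1 * psv (fun n => n.+1%:R^-1) x).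
  by rewrite /b psvZ // psvD ?psvZ //; exact: unit_radiusZ.
have le1 : psv e x <= psv b x.
  by apply: psv_le => // n; rewrite (le_trans (ler_norm _)).
have le2 : - psv b x <= psv e x.
  rewrite -mulN1r -psvZ //; apply: psv_le => //; first exact: unit_radiusZ.
  by move=> n; rewrite mulN1r lerNl (le_trans _ (eb n)) // -normrN ler_norm.
have {le1 le2} : `|psv e x| <= psv b x by rewrite ler_norml le1 le2.
move=> /(ler_wpM2l (ltW e0)); rewrite normrM (gtr0_norm e0) => /le_trans; apply.
have -> : eps * psv b x = C * 2^-1 * (t * (eps * psv (fun=> 1) x) +
    t * psv (fun n => n.+1%:R^-1) x).
  by rewrite bE -{1 2}tt; field; rewrite gt_eqF.
rewrite p1 mulr1 -mulrA ler_wpM2l // ler_pdivrMl //.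
rewrite -[X in X + _]mulr1 -mulrDr mulrCA ler_pM2l //; lra.
Unshelve. all: by end_near. Qed.

End Regularization.

(** * The regularized polynomials: comparison and product formulas *)

Section ZetaPolynomials.
Variable R : realType.
Implicit Types (k : idx) (P Q : {poly R}).

Lemma zeta_stE k P : expands \oo (@lnM R) (ztrunc R k) P -> zeta_st R k = P.
Proof.
move=> /expands_cvg h; rewrite /zeta_st; case: pselect => [ex|[]]; last by exists P.
exact: (expands_weak_unique (@lnM_pinfty R) (projT2 (cid ex)) h).
Qed.

Lemma zeta_shE k Q :
  expands 0^'+ (@lnV R) (fun eps => itint (word R k) (1 - eps)) Q -> zeta_sh R k = Q.
Proof.
move=> /expands_cvg h; rewrite /zeta_sh; case: pselect => [ex|[]]; last by exists Q.
exact: (expands_weak_unique (@lnV_pinfty R) (projT2 (cid ex)) h).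
Qed.

(** The shuffle square of [dt/(1 - t)] is twice the word of (1, 1). *)
Lemma itint_ones (x : R) : 0 <= x -> x < 1 ->
  itint (word R [:: pos 1; pos 1]) x = 2^-1 * (- ln (1 - x)) ^+ 2.
Proof.
move=> x0 x1; have s1 : (1 : R) ^+ 2 == 1 by rewrite expr1n.
have -> : word R [:: pos 1; pos 1] = [:: Some 1; Some 1] by rewrite /word /= !mulr1.
have g1 : admissible [:: Some (1 : R)] by rewrite /= s1.
rewrite itint_psv //; last by rewrite /= s1.
have := psv_shuffle s1 g1 x0 x1.
rewrite [insertions _ _]/= !big_cons big_nil addr0 psv_wcoef_log // => h.
by rewrite expr2 h; field.
Qed.

(** By [itint_word] the integral is linear in the truncated sums, so each basis element of the
    expansion is replaced by its own integral. *)
Lemma expands_itint k c d (r : R) : positive_idx k -> expansion k c d r ->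
  expands 0^'+ (@lnV R) (fun eps => itint (word R k) (1 - eps))
    (c%:P + d *: 'X + r *: (2^-1 *: 'X ^+ 2)).
Proof.
move=> pk hk; have h := expands_abel_rate hk.
rewrite -[X in expands _ _ _ X]add0r.
apply: (expands_near_eq _ (expandsD h (expands_poly _ _))); near=> eps.
have e0 : 0 < eps by near: eps; exact: nbhs_right_gt.
have e1 : eps < 1 by near: eps; apply: nbhs_right_lt.
set x := 1 - eps; have x0 : 0 <= x by rewrite /x; lra.
have x1 : x < 1 by rewrite /x; lra.
have x1' : `|x| < 1 by rewrite ger0_norm.
have rad k' : positive_idx k' -> unit_radius (ztrunc R k').
  by move=> pk'; apply: growth_radius; exact: ztrunc_growth.
have ex : eps = 1 - x by rewrite /x subKr.
pose h1 := ztrunc R [:: pos 1]; pose h2 := ztrunc R [:: pos 1; pos 1].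
have r0 := rad [::] isT; have r1 := rad [:: pos 1] isT.
have r2 := rad [:: pos 1; pos 1] isT; have rk := rad k pk.
(* The constant is written with [ztrunc [::]], so that it too is treated as an iterated integral,
   that of the empty word. *)
have -> : (fun M => ztrunc R k M - (c + d * h1 M + r * h2 M)) = (fun M =>
    ztrunc R k M + ((- c) * ztrunc R [::] M + ((- d) * h1 M + (- r) * h2 M))).
  by apply/funext => M /=; ring.
have rZ0 : unit_radius (fun M => - c * ztrunc R [::] M) by exact: unit_radiusZ.
have rZ1 : unit_radius (fun M => - d * h1 M) by exact: unit_radiusZ.
have rZ2 : unit_radius (fun M => - r * h2 M) by exact: unit_radiusZ.
have rD1 : unit_radius (fun M => - d * h1 M + - r * h2 M) by exact: unit_radiusD.
have rD0 : unit_radius (fun M => - c * ztrunc R [::] M + (- d * h1 M + - r * h2 M)).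
  exact: unit_radiusD.
rewrite (psvD rk rD0 x1') (psvD rZ0 rD1 x1') (psvD rZ1 rZ2 x1').
rewrite (psvZ _ r0 x1') (psvZ _ r1 x1') (psvZ _ r2 x1').
have E k' : positive_idx k' -> eps * psv (ztrunc R k') x = itint (word R k') x.
  by move=> pk'; rewrite itint_word // -ex.
have E0 : eps * psv (ztrunc R [::]) x = 1 by rewrite E.
have E1 : eps * psv h1 x = lnV eps.
  have w1 : word R [:: pos 1] = [:: Some 1] by rewrite /word /= !mulr1.
  rewrite E // w1 itint_psv //; last by rewrite /= expr1n eqxx.
  by rewrite psv_wcoef_log // -ex.
have E2 : eps * psv h2 x = 2^-1 * lnV eps ^+ 2 by rewrite E // itint_ones // -ex.
rewrite -E // !hornerD hornerC !hornerZ hornerX hornerXn.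
transitivity (eps * psv (ztrunc R k) x - c * (eps * psv (ztrunc R [::]) x)
  - d * (eps * psv h1 x) - r * (eps * psv h2 x)
  + (c + d * lnV eps + r * (2^-1 * lnV eps ^+ 2))); first by ring.
by rewrite E0 E1 E2; ring.
Unshelve. all: by end_near. Qed.

Lemma zeta_st_expands k : positive_idx k -> low_lead k ->
  expands \oo (@lnM R) (ztrunc R k) (zeta_st R k).
Proof.
move=> pk lk; have [c [d [r /expands_ztrunc h]]] := expansion_lead2 R pk lk.
by rewrite (zeta_stE h).
Qed.

Lemma zeta_sh_expands k : positive_idx k -> low_lead k ->
  expands 0^'+ (@lnV R) (fun eps => itint (word R k) (1 - eps)) (zeta_sh R k).
Proof.
move=> pk lk; have [c [d [r /(expands_itint pk) h]]] := expansion_lead2 R pk lk.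
by rewrite (zeta_shE h).
Qed.

Lemma zeta_st_convergent k : positive_idx k -> convergent_idx k ->
  zeta_st R k = (zeta R k)%:P.
Proof. by move=> pk ck; apply/zeta_stE/expands_convergent. Qed.

(** With at most one leading 1 the expansion has no [ztrunc [1, 1]] term, the only one on which the
    regularizations disagree. *)
Lemma zeta_sh_st k : positive_idx k -> convergent_idx k || convergent_idx (behead k) ->
  zeta_sh R k = zeta_st R k.
Proof.
move=> pk ck; have [c [d h]] := expansion_lead1 R pk ck.
rewrite (zeta_shE (expands_itint pk h)) (zeta_stE (expands_ztrunc h)).
by rewrite !scale0r.
Qed.

Lemma zeta_sh_convergent k : positive_idx k -> convergent_idx k ->
  zeta_sh R k = (zeta R k)%:P.
Proof. by move=> pk ck; rewrite zeta_sh_st ?ck // zeta_st_convergent. Qed.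

(** Two shifts carry [zeta k] to the coefficient of [ztrunc [1, 1]], where the two polynomials
    differ by zeta(2) / 2. *)
Lemma zeta_sh_ones k : positive_idx k -> convergent_idx k ->
  zeta_sh R [:: pos 1, pos 1 & k] =
  zeta_st R [:: pos 1, pos 1 & k] + (2^-1 * zeta R [:: pos 2] * zeta R k)%:P.
Proof.
move=> pk ck.
have [c h1] := expansion_cons1 (expansion_convergent R pk ck).
have [c' h2] := expansion_cons1 h1.
have pk' : positive_idx [:: pos 1, pos 1 & k] by [].
rewrite (zeta_shE (expands_itint pk' h2)) (zeta_stE (expands_ztrunc h2)).
rewrite -!mul_polyC !polyCM; ring.
Qed.

(** The finite identity passes to the polynomials by uniqueness of expansions. *)
Lemma zeta_st_stuffle1 p k : (0 < p.1)%N -> positive_idx k ->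
  low_lead [:: p] -> low_lead k ->
  (forall k', k' \in stuffle1 p k -> positive_idx k' && low_lead k') ->
  zeta_st R [:: p] * zeta_st R k = \sum_(k' <- stuffle1 p k) zeta_st R k'.
Proof.
move=> p0 pk lp lk hk.
have pp : positive_idx [:: p] by rewrite /= p0.
apply: (expands_unique (@lnM_pinfty R)
  (expandsM (zeta_st_expands pp lp) (zeta_st_expands pk lk))).
apply: (expands_eq (f := fun M => \sum_(k' <- stuffle1 p k) ztrunc R k' M)).
  by move=> M; rewrite ztrunc_stuffle1.
by apply: expands_sum => k' /hk/andP[? ?]; exact: zeta_st_expands.
Qed.

(** The list [ks] decodes the inserted words as indices, so that each integral is again a
    regularized value. *)
Lemma zeta_sh_shuffle1 b k (ks : seq idx) : positive_idx k -> low_lead k ->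
  insertions (Some (zsign R b)) (word R k) = map (word R) ks ->
  (forall k', k' \in ks -> positive_idx k' && low_lead k') ->
  zeta_sh R [:: (1%N, b)] * zeta_sh R k = \sum_(k' <- ks) zeta_sh R k'.
Proof.
move=> pk lk hks hk.
have lb : low_lead [:: (1%N, b)] by rewrite /low_lead /= orbT.
apply: (expands_unique (@lnV_pinfty R) (expandsM
  (zeta_sh_expands (k := [:: (1%N, b)]) isT lb) (zeta_sh_expands pk lk))).
apply: (expands_near_eq (f := fun eps => \sum_(k' <- ks) itint (word R k') (1 - eps))).
  near=> eps.
  have e0 : 0 < eps by near: eps; exact: nbhs_right_gt.
  have e1 : eps < 1 by near: eps; apply: nbhs_right_lt.
  have x0 : 0 <= 1 - eps by lra.
  have x1 : 1 - eps < 1 by lra.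
  have adm k' : admissible (word R k') by apply: word_aux_admissible; rewrite expr1n.
  have bb : zsign R b ^+ 2 == 1 by rewrite zsign_sqr.
  have w1 : word R [:: (1%N, b)] = [:: Some (zsign R b)] by rewrite /word /= mul1r.
  rewrite [X in _ = X * _]itint_psv // [X in _ = _ * X]itint_psv // w1.
  rewrite psv_shuffle // hks big_map; apply: eq_bigr => k' _.
  by rewrite itint_psv.
by apply: expands_sum => k' /hk/andP[? ?]; exact: zeta_sh_expands.
Unshelve. all: by end_near. Qed.

(** Applied to the word of (1, u) without its first letter: inserting into the block of [dt/t]
    splits u, while insertion after the last letter is kept apart as an extreme term. *)
Lemma insertions_nseq (f g h : option R) m :
  insertions f (nseq m g ++ [:: h]) =
  rcons [seq nseq j g ++ f :: nseq (m - j) g ++ [:: h] | j <- iota 0 m.+1]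
    (nseq m g ++ [:: h; f]).
Proof.
elim: m => [//|m IH]; rewrite [nseq m.+1 g ++ _]/= [insertions _ _]/= IH.
have -> : iota 0 m.+2 = 0%N :: map S (iota 0 m.+1) by rewrite -(iotaDl 1 0).
by rewrite map_rcons -map_comp map_cons rcons_cons -map_comp.
Qed.

End ZetaPolynomials.

(** * Shuffle and stuffle expansions of the product of (1) and (1, u) *)

Section SumFormula.
Variable R : realType.

(* [e1], [e2], [e3] are the signs of the partial products [a_1], [a_2], [a_3]:
   the sum over [b] inserts [dt/(a_2 - t)] between the letters
   [dt/(a_1 - t)] and [dt/(a_3 - t)] of the word of [(1, u)]. *)
Lemma zeta_sh_sum (e1 e2 e3 : bool) u : (1 < u)%N ->
  \sum_(1 <= b < u.+1) zeta_sh R [:: (1%N, e1); (b, e1 (+) e2); ((u.+1 - b)%N, e2 (+) e3)] =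
  zeta_sh R [:: (1%N, e2)] * zeta_sh R [:: (1%N, e1); (u, e1 (+) e3)]
  - zeta_sh R [:: (1%N, e2); (1%N, e1 (+) e2); (u, e1 (+) e3)]
  - zeta_sh R [:: (1%N, e1); (u, e1 (+) e3); (1%N, e2 (+) e3)].
Proof.
move=> u1; rewrite (@zeta_sh_shuffle1 R _ _
  ([:: (1%N, e2); (1%N, e1 (+) e2); (u, e1 (+) e3)] ::
   rcons [seq [:: (1%N, e1); (b, e1 (+) e2); ((u.+1 - b)%N, e2 (+) e3)] | b <- iota 1 u]
     [:: (1%N, e1); (u, e1 (+) e3); (1%N, e2 (+) e3)])).
- rewrite big_cons big_rcons big_map /index_iota subn1 /=.
  by ring.
- by rewrite /= ltnW.
- by rewrite /low_lead /= !orbT.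
- case: u u1 => // u _; rewrite /word /= !mul1r.
  have zz a b : zsign R a * zsign R (a (+) b) = zsign R b.
    by case: a b => [] [] /=; rewrite ?mulrNN ?mulr1 ?mul1r.
  rewrite !zz insertions_nseq !map_rcons -!map_comp /=.
  have zz' a b : zsign R a * zsign R (b (+) a) = zsign R b by rewrite addbC zz.
  rewrite !mul1r !(zz, zz') subn0; congr [:: _, _ & rcons _ _].
  (* An argument b comes from b - 1 letters [dt/t] before the inserted letter, hence the shift of
     the range. *)
  rewrite (iotaDl 1 1) -map_comp; apply: eq_map => j /=.
  by rewrite mul1r !(zz, zz') add1n !subSS predn_sub.
- have u0 := ltnW u1; have hu b : (u, b) != pos 1 by rewrite /pos xpair_eqE gtn_eqF.
  move=> k'; rewrite inE mem_rcons inE => /or3P[/eqP ->|/eqP ->|/mapP[b + ->]].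
  + by rewrite /low_lead /= u0 hu !orbT.
  + by rewrite /low_lead /= u0 hu !orbT.
  rewrite mem_iota add1n ltnS => /andP[b1 bu].
  rewrite /low_lead /= b1 subn_gt0 ltnS bu /=.
  (* For b = 1 the last argument is u > 1, so there are never three leading ones. *)
  case: (eqVneq b 1%N) => [->|bn1].
    by rewrite subn1 /= hu !orbT.
  have -> : (b, e1 (+) e2) != pos 1 by rewrite /pos xpair_eqE (negbTE bn1).
  by rewrite !orbT.
Qed.

(** All five terms have at most two leading ones because u > 1; this is where w >= 4 enters. *)
Lemma zeta_st_prod (e1 e2 e : bool) u : (1 < u)%N ->
  zeta_st R [:: (1%N, e2)] * zeta_st R [:: (1%N, e1); (u, e)] =
  zeta_st R [:: (1%N, e2); (1%N, e1); (u, e)] + zeta_st R [:: (2%N, e2 (+) e1); (u, e)]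
  + zeta_st R [:: (1%N, e1); (1%N, e2); (u, e)] + zeta_st R [:: (1%N, e1); (u.+1, e2 (+) e)]
  + zeta_st R [:: (1%N, e1); (u, e); (1%N, e2)].
Proof.
move=> u1; have u0 := ltnW u1.
have hu b : (u, b) != pos 1 by rewrite /pos xpair_eqE gtn_eqF.
have pk : positive_idx [:: (1%N, e1); (u, e)] by rewrite /= u0.
have lp : low_lead [:: (1%N, e2)] by rewrite /low_lead /= orbT.
have lk : low_lead [:: (1%N, e1); (u, e)] by rewrite /low_lead /= !orbT.
rewrite zeta_st_stuffle1 // => [|k'].
  by rewrite [stuffle1 _ _]/= !big_cons big_nil add1n addr0 !addrA.
rewrite !inE => /or4P[/eqP ->|/eqP ->|/eqP ->|/orP[] /eqP ->].
all: by rewrite /low_lead /= ?u0 ?hu ?orbT.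
Qed.

End SumFormula.

(** * The eight sum formulas *)

Theorem theorem5p4 (R : realType) (w : nat) (hw : (4 <= w)%N) :
  let u := (w - 2)%N in
  let v := (w - 1)%N in
  (
   \sum_(1 <= b < v) zeta_sh R [:: pos 1; pos b; pos (v - b)]
     = (zeta R [:: pos 2; pos u])%:P + zeta_st R [:: pos 1; pos v]
       + zeta_st R [:: pos 1; pos 1; pos u]
       - (2^-1 * zeta R [:: pos 2] * zeta R [:: pos u])%:P) /\ (
   \sum_(1 <= b < v) zeta_sh R [:: pos 1; bar b; pos (v - b)]
     = (zeta R [:: bar 2; bar u])%:P + zeta_st R [:: pos 1; pos v]
       + zeta_st R [:: pos 1; bar 1; bar u] + zeta_st R [:: pos 1; bar u; bar 1]
       + (zeta R [:: bar 1; pos 1; bar u])%:P - (zeta R [:: bar 1; bar 1; bar u])%:P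
       - zeta_st R [:: pos 1; bar u; pos 1]) /\ (
   \sum_(1 <= b < v) zeta R [:: bar 1; pos b; pos (v - b)]
     = zeta R [:: pos 2; pos u] + zeta R [:: bar 1; bar v]
       + zeta R [:: bar 1; pos u; bar 1] + 2 * zeta R [:: bar 1; bar 1; pos u]
       - zeta R [:: bar 1; pos 1; pos u] - zeta R [:: bar 1; pos u; pos 1]) /\ (
   \sum_(1 <= b < v) zeta R [:: bar 1; bar b; pos (v - b)]
     = zeta R [:: bar 2; bar u] + zeta R [:: bar 1; bar v]
       + zeta R [:: bar 1; pos 1; bar u]) /\ (
   \sum_(1 <= b < v) zeta R [:: bar 1; bar b; bar (v - b)]
     = zeta R [:: bar 2; pos u] + zeta R [:: bar 1; pos v]
       + zeta R [:: bar 1; pos u; pos 1] + zeta R [:: bar 1; pos 1; pos u]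
       - zeta R [:: bar 1; pos u; bar 1]) /\ (
   \sum_(1 <= b < v) zeta_sh R [:: pos 1; pos b; bar (v - b)]
     = (zeta R [:: pos 2; bar u])%:P + zeta_st R [:: pos 1; bar v]
       + zeta_st R [:: pos 1; bar u; pos 1] + zeta_st R [:: pos 1; pos 1; bar u]
       - zeta_sh R [:: pos 1; bar u; bar 1]
       - (2^-1 * zeta R [:: pos 2] * zeta R [:: bar u])%:P) /\ (
   \sum_(1 <= b < v) zeta_sh R [:: pos 1; bar b; bar (v - b)]
     = (zeta R [:: bar 2; pos u])%:P + zeta_st R [:: pos 1; bar v]
       + zeta_st R [:: pos 1; bar 1; pos u]
       + (zeta R [:: bar 1; pos 1; pos u])%:P - (zeta R [:: bar 1; bar 1; pos u])%:P) /\ (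
   \sum_(1 <= b < v) zeta R [:: bar 1; pos b; bar (v - b)]
     = zeta R [:: pos 2; bar u] + zeta R [:: bar 1; pos v]
       + 2 * zeta R [:: bar 1; bar 1; bar u] - zeta R [:: bar 1; pos 1; bar u]).
Proof.
move=> u v.
have [u1 vE] : (1 < u)%N /\ v = u.+1.
  by rewrite {}/u {}/v; case: w hw => [|[|[|[|w']]]].
clearbody u v; subst v; clear w hw.
have u0 := ltnW u1.
have hu b : (u, b) != pos 1 by rewrite /pos xpair_eqE gtn_eqF.
have S e1 e2 e3 := zeta_sh_sum R e1 e2 e3 u1.
have P e1 e2 e := zeta_st_prod R e1 e2 e u1.
(* A dictionary follows: every regularized value produced by the two product expansions is rewritten
   by [zeta_st] or, if convergent, by a constant. *)
have sh1 b : zeta_sh R [:: (1%N, b)] = zeta_st R [:: (1%N, b)].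
  by apply: zeta_sh_st; rewrite //= orbT.
have sh2 e1 e : zeta_sh R [:: (1%N, e1); (u, e)] = zeta_st R [:: (1%N, e1); (u, e)].
  by apply: zeta_sh_st; rewrite /= ?u0 ?hu ?orbT.
have sh3 e1 e2 e : zeta_sh R [:: (1%N, e1); (u, e2); (1%N, e)] =
    zeta_st R [:: (1%N, e1); (u, e2); (1%N, e)].
  by apply: zeta_sh_st; rewrite /= ?u0 ?hu ?orbT.
have sh4 e : zeta_sh R [:: (1%N, false); (1%N, true); (u, e)] =
    zeta_st R [:: (1%N, false); (1%N, true); (u, e)].
  by apply: zeta_sh_st; rewrite /= ?u0.
have sh5 e1 e : zeta_sh R [:: (1%N, true); (1%N, e1); (u, e)] =
    (zeta R [:: (1%N, true); (1%N, e1); (u, e)])%:P.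
  by apply: zeta_sh_convergent; rewrite /= ?u0.
(* The only correction term; it arises when a_1 = a_2 = 1, that is in the first and sixth
   identities. *)
have sh6 e : zeta_sh R [:: (1%N, false); (1%N, false); (u, e)] =
    zeta_st R [:: (1%N, false); (1%N, false); (u, e)]
    + (2^-1 * zeta R [:: pos 2] * zeta R [:: (u, e)])%:P.
  by apply: zeta_sh_ones; rewrite /= ?u0.
have st1 e1 e : zeta_st R [:: (2%N, e1); (u, e)] = (zeta R [:: (2%N, e1); (u, e)])%:P.
  by apply: zeta_st_convergent; rewrite /= ?u0.
have st2 s e : (0 < s)%N -> zeta_st R [:: (1%N, true); (s, e)] =
    (zeta R [:: (1%N, true); (s, e)])%:P.
  by move=> s0; apply: zeta_st_convergent; rewrite /= ?s0.
have st4 e1 e : zeta_st R [:: (1%N, true); (1%N, e1); (u, e)] =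
    (zeta R [:: (1%N, true); (1%N, e1); (u, e)])%:P.
  by apply: zeta_st_convergent; rewrite /= ?u0.
have shc b e1 e : (0 < b < u.+1)%N -> zeta_sh R [:: (1%N, true); (b, e1); ((u.+1 - b)%N, e)] =
    (zeta R [:: (1%N, true); (b, e1); ((u.+1 - b)%N, e)])%:P.
  by move=> /andP[b0 bu]; apply: zeta_sh_convergent; rewrite /= ?b0 ?subn_gt0 ?bu.
(* The identities starting with a barred 1 are between numbers; as constant polynomials they follow
   from the same shuffle formula. *)
have conv e1 e : (\sum_(1 <= b < u.+1) zeta R [:: (1%N, true); (b, e1); ((u.+1 - b)%N, e)])%:P =
    \sum_(1 <= b < u.+1) zeta_sh R [:: (1%N, true); (b, e1); ((u.+1 - b)%N, e)].
  by rewrite rmorph_sum; apply: eq_big_nat => b hb; rewrite shc.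
have st3 e1 e : zeta_st R [:: (1%N, true); (u, e1); (1%N, e)] =
    (zeta R [:: (1%N, true); (u, e1); (1%N, e)])%:P.
  by apply: zeta_st_convergent; rewrite /= ?u0.
pose E := (sh1, sh2, sh3, sh4, sh5, sh6, P, st1, st2, st3, st4).
rewrite /pos /bar; split; [|split; [|split; [|split; [|split; [|split; [|split]]]]]].
(* In each case the arguments of [S] are the signs of the partial products of the index summed on
   the left. *)
- by rewrite (S false false false) /= !E /=; ring.
- by rewrite (S false true true) /= !E /=; ring.
- apply: polyC_inj; rewrite conv (S true true true) /= !E //= !(polyCD, polyCM, polyCN).
  by ring.
- apply: polyC_inj; rewrite conv (S true false false) /= !E //= !(polyCD, polyCM, polyCN).
  by ring.
- apply: polyC_inj; rewrite conv (S true false true) /= !E //= !(polyCD, polyCM, polyCN).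
  by ring.
- by rewrite (S false false true) /= !E /=; ring.
- by rewrite (S false true false) /= !E /=; ring.
- apply: polyC_inj; rewrite conv (S true true false) /= !E //= !(polyCD, polyCM, polyCN).
  by ring.
Qed.
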